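(* For any $m\in\mathbb{Z}\setminus\{0\}$ and $\xi\in\mathbb{Z}_m$, the group $\overline{BS}(m,\xi)$ (1) has the Haagerup property; (2) is residually solvable.
   Context: A marked group on $k$ generators is a pair $(G,S)$ with $S=(s_1,\dots,s_k)\in G^k$ generating $G$, considered up to isomorphisms respecting the markings. $\mathcal{G}_k$ is the set of marked groups on $k$ generators with the ultrametric $d((G_1,S_1),(G_2,S_2))=e^{-\lambda}$, where $\lambda$ is the word length of a shortest element of the free group $\mathbb{F}_k$ that is trivial in one group and not in the other. For $m,n\in\mathbb{Z}\setminus\{0\}$, $BS(m,n)=\langle a,b\mid ab^ma^{-1}=b^n\rangle$, marked by $(a,b)$. The ring of $m$-adic integers is $\mathbb{Z}_m=\varprojlim_h \mathbb{Z}/m^h\mathbb{Z}$ (the zero ring if $|m|=1$). For $\xi\in\mathbb{Z}_m$, $\overline{BS}(m,\xi)=\lim_{n\to\infty}BS(m,\xi_n)$ in $\mathcal{G}_2$, where $(\xi_n)_n$ is any sequence of non-zero rational integers with $|\xi_n|\to\infty$ and $\xi_n\to\xi$ in $\mathbb{Z}_m$ (it is known that this limit exists and does not depend on the choice of $(\xi_n)_n$). A countable discrete group has the Haagerup property if it admits a metrically proper affine isometric action on a Hilbert space (equivalently, a proper conditionally negative definite function). A group is residually solvable if every non-trivial element has non-trivial image in some solvable quotient. *)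

(* Defs.v *)
From HB Require Import structures.
From mathcomp Require Import all_boot all_order all_algebra.
From mathcomp Require Import sesquilinear.
From mathcomp Require Import all_classical all_reals all_analysis.

Set Implicit Arguments.
Unset Strict Implicit.
Unset Printing Implicit Defensive.

Import Order.TTheory GRing.Theory Num.Theory.
Import numFieldNormedType.Exports.

Local Open Scope classical_set_scope.
Local Open Scope ring_scope.

Section Subgroups.
Variable G : groupType.

Definition is_subgroup (H : set G) : Prop :=
  H 1%g /\ forall x y, H x -> H y -> H (x * y^-1)%g.

Definition subgroup_gen (A : set G) : set G := smallest is_subgroup A.

Fixpoint derived (n : nat) : set G :=
  if n is n'.+1 then
    subgroup_gen
      [set [~ p.1, p.2]%g | p in [set p : G * G | derived n' p.1 /\ derived n' p.2]]
  else setT.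

Definition solvable_group : Prop := exists n, derived n = [set 1%g].

End Subgroups.

Definition residually_solvable (G : groupType) : Prop :=
  forall g : G, g <> 1%g ->
    exists (Q : groupType) (q : {multiplicative G -> Q}),
      [/\ solvable_group Q, (forall y : Q, exists x : G, q x = y) & q g <> 1%g].

(* The letter (i, false) stands for s_i and (i, true) for s_i^-1; words need
   not be reduced. *)
Definition word (k : nat) := seq ('I_k * bool).

Definition inv_letter k (c : 'I_k * bool) : 'I_k * bool := (c.1, ~~ c.2).

Definition inv_word k (w : word k) : word k := rev (map (@inv_letter k) w).

Definition word_eval k (G : groupType) (s : 'I_k -> G) (w : word k) : G :=
  (\prod_(c <- w) (if c.2 then (s c.1)^-1 else s c.1))%g.

Record marked_group (k : nat) := MarkedGroup {
  mg_group :> groupType;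
  mg_gen : 'I_k -> mg_group;
  mg_genP : subgroup_gen (range mg_gen) = setT }.

(* Length n is attained by an element of the free group that is trivial in
   exactly one of G1, G2. The word length of a free group element is the least
   length of a word representing it, so the minimum below may be taken over all
   words, reduced or not. *)
Definition distinguishing_length k (G1 G2 : marked_group k) (n : nat) : Prop :=
  exists2 w : word k, size w = n &
    ~ (word_eval (@mg_gen k G1) w = 1%g <-> word_eval (@mg_gen k G2) w = 1%g).

(* A marked group is a representative of its class: the distance is 0 exactly
   when there is an isomorphism respecting the markings. *)
Definition marked_dist (R : realType) k (G1 G2 : marked_group k) : R :=
  match pselect (exists n, `[< distinguishing_length G1 G2 n >]) with
  | left ex => expR (- (ex_minn ex)%:R)
  | right _ => 0
  end.

Section Presentations.
Variables (k : nat) (rel : word k -> word k -> Prop).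

Inductive pres_eq : word k -> word k -> Prop :=
| pres_refl w : pres_eq w w
| pres_sym v w : pres_eq v w -> pres_eq w v
| pres_trans u v w : pres_eq u v -> pres_eq v w -> pres_eq u w
| pres_cat u u' v v' : pres_eq u u' -> pres_eq v v' -> pres_eq (u ++ v) (u' ++ v')
| pres_cancel c : pres_eq [:: c; inv_letter c] [::]
| pres_rel u v : rel u v -> pres_eq u v.

Definition pres_eqb (u v : word k) : bool := `[< pres_eq u v >].

Lemma pres_eqb_equiv : equiv_class_of pres_eqb.
Proof.
split=> [w|u v|v u w].
- exact/asboolP/pres_refl.
- by apply/asboolP/asboolP => /pres_sym.
- by move=> /asboolP uv /asboolP vw; apply/asboolP; exact: pres_trans uv vw.
Qed.

Canonical pres_equiv := EquivRelPack pres_eqb_equiv.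

(* Quotient of the words by the congruence above, i.e. the group generated by
   'I_k subject to the relations rel. *)
Definition presented := {eq_quot pres_equiv}%qT.

HB.instance Definition _ := Choice.on presented.

Definition presented_pi (w : word k) : presented := (\pi w)%qT.

Lemma presented_piE u v : presented_pi u = presented_pi v <-> pres_eq u v.
Proof.
by split=> [/eqquotP/asboolP//|uv]; apply/eqquotP/asboolP.
Qed.

Lemma presented_reprK (x : presented) : presented_pi (repr x) = x.
Proof. exact: reprK. Qed.

Lemma pres_repr w : pres_eq (repr (presented_pi w)) w.
Proof. by apply/presented_piE; rewrite presented_reprK. Qed.

Lemma inv_letterK : involutive (@inv_letter k).
Proof. by case=> i b; rewrite /inv_letter negbK. Qed.

Lemma inv_wordK : involutive (@inv_word k).
Proof.
by move=> w; rewrite /inv_word map_rev revK -map_comp -[RHS]map_id;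
  apply: eq_map => c /=; rewrite inv_letterK.
Qed.

Lemma inv_word_cat u v : inv_word (u ++ v) = inv_word v ++ inv_word u :> word k.
Proof. by rewrite /inv_word map_cat rev_cat. Qed.

Lemma pres_mulwV w : pres_eq (w ++ inv_word w) [::].
Proof.
elim: w => [|c w IHw]; first exact: pres_refl.
rewrite /inv_word /= rev_cons -cats1 -/(inv_word w).
have -> : c :: w ++ inv_word w ++ [:: inv_letter c] =
          [:: c] ++ ((w ++ inv_word w) ++ [:: inv_letter c]) by rewrite /= catA.
apply: pres_trans (pres_cancel c).
apply: pres_cat (pres_refl _) _.
exact: pres_cat IHw (pres_refl _).
Qed.

Lemma pres_mulVw w : pres_eq (inv_word w ++ w) [::].
Proof. by rewrite -{2}[w]inv_wordK; exact: pres_mulwV. Qed.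

Lemma pres_inv u v : pres_eq u v -> pres_eq (inv_word u) (inv_word v).
Proof.
move=> uv; apply: (@pres_trans _ (inv_word u ++ (v ++ inv_word v))).
  rewrite -[X in pres_eq X _]cats0.
  by apply: pres_cat (pres_refl _) _; exact/pres_sym/pres_mulwV.
rewrite catA -[X in pres_eq _ X]cat0s; apply: pres_cat (pres_refl _).
apply: pres_trans (pres_mulVw u).
by apply: pres_cat (pres_refl _) _; exact: pres_sym.
Qed.

Definition presented_one : presented := presented_pi [::].
Definition presented_mul (x y : presented) : presented :=
  presented_pi (repr x ++ repr y).
Definition presented_inv (x : presented) : presented :=
  presented_pi (inv_word (repr x)).

Lemma presented_piM u v :
  presented_mul (presented_pi u) (presented_pi v) = presented_pi (u ++ v).
Proof. by apply/presented_piE; apply: pres_cat; exact: pres_repr. Qed.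

Lemma presented_piV u :
  presented_inv (presented_pi u) = presented_pi (inv_word u).
Proof. by apply/presented_piE; apply: pres_inv; exact: pres_repr. Qed.

Lemma presented_mulA : associative presented_mul.
Proof.
move=> x y z.
rewrite -[x]presented_reprK -[y]presented_reprK -[z]presented_reprK.
by rewrite !presented_piM catA.
Qed.

Lemma presented_lid : left_id presented_one presented_mul.
Proof. by move=> x; rewrite -[x]presented_reprK presented_piM. Qed.

Lemma presented_rid : right_id presented_one presented_mul.
Proof. by move=> x; rewrite -[x]presented_reprK presented_piM cats0. Qed.

Lemma presented_linv : left_inverse presented_one presented_inv presented_mul.
Proof.
move=> x; rewrite -[x]presented_reprK presented_piV presented_piM.
exact/presented_piE/pres_mulVw.
Qed.

Lemma presented_rinv : right_inverse presented_one presented_inv presented_mul.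
Proof.
move=> x; rewrite -[x]presented_reprK presented_piV presented_piM.
exact/presented_piE/pres_mulwV.
Qed.

HB.instance Definition _ := isGroup.Build presented
  presented_mulA presented_lid presented_rid presented_linv presented_rinv.

Definition presented_gen (i : 'I_k) : presented := presented_pi [:: (i, false)].

Lemma presented_eval w : word_eval presented_gen w = presented_pi w.
Proof.
rewrite /word_eval; elim: w => [|c w IHw]; first by rewrite big_nil.
rewrite big_cons IHw -[c :: w]cat1s -presented_piM; congr presented_mul.
by case: c => i [] //=; rewrite /presented_gen; exact: presented_piV.
Qed.

Lemma presented_genP : subgroup_gen (range presented_gen) = setT.
Proof.
apply/seteqP; split=> // x _ H [[H1 HB] sH].
have HV y : H y -> H (y^-1)%g by move=> /(HB _ _ H1); rewrite mul1g.
have HM y z : H y -> H z -> H (y * z)%g.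
  by move=> Hy /HV /(HB _ _ Hy); rewrite invgK.
rewrite -[x]presented_reprK -presented_eval /word_eval.
apply: big_rec => // c y _ Hy; apply: HM => //.
have Hc : H (presented_gen c.1) by apply: sH; exists c.1.
by case: c.2 => //; exact: HV.
Qed.

Definition presented_marked : marked_group k := MarkedGroup presented_genP.

End Presentations.

Section BaumslagSolitar.

Definition a_ : 'I_2 := ord0.
Definition b_ : 'I_2 := ord_max.

Definition b_pow (n : int) : word 2 := nseq `|n|%N (b_, (n < 0)%R).

Inductive BS_rel (m n : int) : word 2 -> word 2 -> Prop :=
| BS_relator : BS_rel m n ((a_, false) :: b_pow m ++ [:: (a_, true)]) (b_pow n).

Definition BS (m n : int) : marked_group 2 := presented_marked (BS_rel m n).

End BaumslagSolitar.

(* An element of Z/m^h is given by its remainder in [0, |m|^h), so that the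
   transition map Z/m^h.+1 -> Z/m^h is remainder modulo m^h. In particular the
   inverse limit is a single point when |m| = 1. *)
Record madic (m : int) := MAdic {
  madic_res :> nat -> int;
  madic_resP : forall h, madic_res h = (madic_res h.+1 %% m ^+ h)%Z }.

(* Convergence in the topology of the inverse limit of the discrete Z/m^h. *)
Definition cvg_madic m (u : nat -> int) (xi : madic m) : Prop :=
  forall h, \forall n \near \oo, (u n %% m ^+ h)%Z = xi h.

(* The marked group G represents the limit of BS(m, xi_n). *)
Definition is_BSbar (R : realType) m (xi : madic m) (G : marked_group 2) : Prop :=
  exists xi_ : nat -> int,
    [/\ forall n, xi_ n != 0,
        (fun n => `|xi_ n|%N) @ \oo --> \oo,
        cvg_madic xi_ xi
      & marked_dist R (BS m (xi_ n)) G @[n --> \oo] --> (0 : R)].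

Definition is_affine (R : realType) (V : lmodType R) (f : V -> V) : Prop :=
  exists (A : {linear V -> V}) (b : V), forall v, f v = A v + b.

(* H together with dot is a real Hilbert space: a Banach space whose norm comes
   from an inner product. *)
Definition haagerup (R : realType) (G : groupType) : Prop :=
  exists (H : completeNormedModType R) (dot : {dot H for idfun})
      (alpha : G -> H -> H),
    (forall v, `|v| ^+ 2 = dot v v) /\
    [/\ forall v, alpha 1%g v = v,
        forall g h v, alpha (g * h)%g v = alpha g (alpha h v),
        forall g, is_affine (alpha g),
        forall g v w, `|alpha g v - alpha g w| = `|v - w|
      & forall B : set H, bounded_set B ->
          finite_set [set g | alpha g @` B `&` B !=set0]].

(* Main.v *)
(* Let G be the limit. Fix an ultrafilter on the indices n and let E be the
   group of the elements of G that lie in <b> in BS(m, xi_n) for most n. The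
   presentations of the BS(m, xi_n) show in the limit that G is an HNN extension
   with base E and stable letter a, hence acts on a tree T with vertex set G / E.
   Let F be the kernel of the ultraproduct of the affine representations
   a = (x -> (xi_n / m) x), b = (x -> x + 1). Then G / F is metabelian, and as
   |xi_n| goes to infinity F meets E trivially, so F acts freely on the vertices.

   Residual solvability: if N is the (n+2)-nd derived subgroup of G and f <> 1 is
   in [N, N], then a geodesic from v to f v crosses the N-orbit of some edge in
   both directions, so some nontrivial element of N moves some vertex by less.
   Hence the displacement of the nontrivial elements of the derived subgroups
   tends to infinity and their intersection is trivial.

   Haagerup property: it suffices to find positive definite functions on G that
   are small outside finite sets and close to 1 on given finite sets. As G / F is
   amenable, one may average, over the cosets z in a Folner set of G / F, the
   kernels on T equal to the product of weights of the edges between two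
   vertices, where the weight (seen from z) is r < 1 for finitely many F-orbits
   of edges and 0 for the others. *)

Require Import Defs.
From HB Require Import structures.
From mathcomp Require Import all_boot all_order all_algebra.
From mathcomp Require Import sesquilinear zify ring lra.
From mathcomp Require Import all_classical all_reals all_analysis.

Set Implicit Arguments.
Unset Strict Implicit.
Unset Printing Implicit Defensive.

Import Order.TTheory GRing.Theory Num.Theory.
Import numFieldNormedType.Exports.

Local Open Scope classical_set_scope.
Local Open Scope ring_scope.

(** That the graph on [G / E] is a tree is expressed by counting. The signed number of times a word
    crosses a set of edges is unchanged by the relator of [BS m n], so it depends only on the group
    element. It involves only the finitely many prefixes of the word, so it survives in the limit
    even for sets of edges that are not limits of such sets.

    The tree need not be locally finite, so [r] to the power of the distance need not be proper.
    Keeping only finitely many [F]-orbits of edges makes the graph locally finite, because [F] acts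
    freely on the vertices, but such a choice of orbits is not invariant under [G]. Letting it
    depend on the coset [z] makes the family of kernels equivariant, and the average over a Folner
    set gives back a function on [G]. Where this function is large at [g], the vertex [g E] and the
    coset [g F] are among finitely many; together they determine [g], since [F] and [E] meet
    trivially.

    The count along the derived series starts at the second term because it is the second derived
    subgroup, contained in [F], that meets [E] trivially. *)

Lemma sqr_le_mul (R : realFieldType) (p k n : R) : 0 <= n -> 0 <= k ->
  (forall s, 2 * s * p - s ^+ 2 * k <= n) -> p ^+ 2 <= n * k.
Proof.
move=> n0; rewrite le_eqVlt => /predU1P[<-|k0] h.
  rewrite mulr0; have [->|p0] := eqVneq p 0; first by rewrite expr0n.
  have := h ((n + 1) / (2 * p)); rewrite mulr0 subr0.
  have -> : 2 * ((n + 1) / (2 * p)) * p = n + 1 by field.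
  lra.
have := h (p / k).
have -> : 2 * (p / k) * p - (p / k) ^+ 2 * k = p ^+ 2 / k by field; rewrite gt_eqF.
by rewrite ler_pdivrMr.
Qed.

(** * Inner products from the parallelogram law *)

Section JordanVonNeumann.
Variables (R : realType) (V : lmodType R) (N : V -> R).
Hypothesis N_ge0 : forall x, 0 <= N x.
Hypothesis NZ : forall t x, N (t *: x) = t ^+ 2 * N x.
Hypothesis N_parallelogram :
  forall x y, N (x + y) + N (x - y) = 2 * N x + 2 * N y.

Definition polar x y := (N (x + y) - N (x - y)) / 4.

Lemma N_opp x : N (- x) = N x.
Proof. by rewrite -scaleN1r NZ sqrrN expr1n mul1r. Qed.

Lemma polarC x y : polar x y = polar y x.
Proof. by rewrite /polar [x + y]addrC -(N_opp (x - y)) opprB. Qed.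

Lemma polarxx x : polar x x = N x.
Proof.
rewrite /polar subrr -[in N 0](scale0r x) NZ expr0n mul0r subr0.
rewrite -mulr2n -scaler_nat NZ; lra.
Qed.

(** Jordan and von Neumann: four instances of the parallelogram law add up to additivity once [e1],
    ..., [e6] identify their mixed terms. *)
Lemma polarDl x x' y : polar (x + x') y = polar x y + polar x' y.
Proof.
have P1 := N_parallelogram (x + y) x'.
have P2 := N_parallelogram (x' + y) x.
have P3 := N_parallelogram (x - y) x'.
have P4 := @N_parallelogram (x' - y) x.
have e1 : N (x - y - x') = N (x' + y - x).
  by rewrite -N_opp; congr N; rewrite !opprD !opprK addrC addrAC addrA.
have e2 : N (x' - y - x) = N (x + y - x').
  by rewrite -N_opp; congr N; rewrite !opprD !opprK addrC addrAC addrA.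
have e3 : x + y + x' = x + x' + y by rewrite addrAC.
have e4 : x' + y + x = x + x' + y by rewrite addrAC [x' + x]addrC.
have e5 : x - y + x' = x + x' - y by rewrite addrAC.
have e6 : x' - y + x = x + x' - y by rewrite addrAC [x' + x]addrC.
rewrite e3 in P1; rewrite e4 in P2; rewrite e5 e1 in P3; rewrite e6 e2 in P4.
rewrite /polar; lra.
Qed.

(** A crude bound that precedes Cauchy-Schwarz: the homogeneity of [polar] is deduced from it, and
    Cauchy-Schwarz from the homogeneity. *)
Lemma polar_le x y : `|polar x y| <= (N x + N y) / 2.
Proof.
have := N_parallelogram x y; have := N_ge0 (x + y); have := N_ge0 (x - y).
by rewrite /polar ler_norml; lra.
Qed.

Lemma polar0l y : polar 0 y = 0.
Proof. by rewrite /polar add0r sub0r N_opp subrr mul0r. Qed.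

Lemma polarNl x y : polar (- x) y = - polar x y.
Proof. by apply/eqP; rewrite -addr_eq0 -polarDl addNr polar0l. Qed.

Lemma polarMnl n x y : polar (x *+ n) y = polar x y *+ n.
Proof. by elim: n => [|n IHn]; rewrite ?mulr0n ?polar0l// !mulrS polarDl IHn. Qed.

(* t |-> polar (t *: x) y - t * polar x y is additive and bounded, hence 0. *)
Lemma polarZl t x y : polar (t *: x) y = t * polar x y.
Proof.
pose d s := polar (s *: x) y - s * polar x y.
have dD s s' : d (s + s') = d s + d s' by rewrite /d scalerDl polarDl; lra.
have dMn n s : d (s *+ n) = d s *+ n.
  by rewrite /d -scalerMnl polarMnl mulrnBl mulrnAl.
have d1 : d 1 = 0 by rewrite /d scale1r mul1r subrr.
have dN s : d (- s) = - d s by rewrite /d scaleNr polarNl; lra.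
have dn n : d n%:R = 0 by rewrite dMn d1 mul0rn.
pose C := N x + N y.
have dC01 s : 0 <= s <= 1 -> `|d s| <= C.
  move=> /andP[s0 s1]; rewrite /d /C.
  have := polar_le (s *: x) y; have := polar_le x y.
  have := N_ge0 x; have := N_ge0 y.
  rewrite NZ !ler_norml => Ny Nx /andP[a1 a2] /andP[b1 b2].
  have s2 : s ^+ 2 * N x <= N x by rewrite ler_piMl// expr_le1.
  have h1 : s * polar x y <= (N x + N y) / 2 by nra.
  have h2 : - ((N x + N y) / 2) <= s * polar x y by nra.
  by apply/andP; split; lra.
have dC s : `|d s| <= C.
  wlog s0 : s / 0 <= s.
    move=> W; have [/W//|s0] := leP 0 s.
    by rewrite -normrN -dN; apply: W; rewrite oppr_ge0 ltW.
  have /andP[t1 t2] := truncn_itv s0.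
  rewrite -[s](subrK (Num.truncn s)%:R) dD dn addr0; apply: dC01.
  by rewrite subr_ge0 t1 lerBlDl natr1 ltW.
suff -> : polar (t *: x) y = d t + t * polar x y.
  suff -> : d t = 0 by rewrite add0r.
  apply/eqP/negPn/negP => dt0.
  have dt : 0 < `|d t| by rewrite normr_gt0.
  have C0 : 0 <= C / `|d t| by rewrite divr_ge0// addr_ge0.
  have /andP[_] := truncn_itv C0; set n := (Num.truncn _).+1.
  rewrite ltr_pdivrMr// mulr_natl -normrMn -dMn => /lt_geF.
  by rewrite dC.
by rewrite /d subrK.
Qed.

Lemma polarDZ s x y : N (x + s *: y) = N x + 2 * s * polar x y + s ^+ 2 * N y.
Proof.
have P := N_parallelogram x (s *: y); rewrite NZ in P.
have : polar x (s *: y) = s * polar x y by rewrite polarC polarZl polarC.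
rewrite {1}/polar; lra.
Qed.

Lemma polar_CS x y : polar x y ^+ 2 <= N x * N y.
Proof.
apply: sqr_le_mul => // s.
by have := N_ge0 (x + (- s) *: y); rewrite polarDZ; lra.
Qed.

Lemma sqrtN_triangle x y :
  Num.sqrt (N (x + y)) <= Num.sqrt (N x) + Num.sqrt (N y).
Proof.
have cs : polar x y <= Num.sqrt (N x) * Num.sqrt (N y).
  rewrite -sqrtrM// (le_trans (ler_norm _))// -sqrtr_sqr ler_wsqrtr//.
  exact: polar_CS.
rewrite -[leRHS]ger0_norm ?addr_ge0 ?sqrtr_ge0// -sqrtr_sqr ler_wsqrtr//.
by have := polarDZ 1 x y; rewrite scale1r sqrrD !sqr_sqrtr//; lra.
Qed.
End JordanVonNeumann.

(** * Reproducing kernel Hilbert spaces *)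

Section ReproducingKernel.
Variables (R : realType) (X : Type).
Implicit Types (K : X -> X -> R) (c d : seq (R * X)) (f g : X -> R).

(** The list [c] is a formal combination of points in which repetitions are allowed, so that
    concatenation is addition. *)
Definition lin_eval c f : R := \sum_(u <- c) u.1 * f u.2.

Definition kform K c d : R := lin_eval c (fun x => lin_eval d (K x)).

Definition psd_kernel K : Prop :=
  (forall x y, K x y = K y x) /\ forall c, 0 <= kform K c c.

Definition scale_seq (t : R) c := [seq (t * u.1, u.2) | u <- c].

Lemma lin_eval_cat c d f : lin_eval (c ++ d) f = lin_eval c f + lin_eval d f.
Proof. exact: big_cat. Qed.

Lemma lin_eval_scale t c f : lin_eval (scale_seq t c) f = t * lin_eval c f.
Proof.
by rewrite /lin_eval big_map mulr_sumr; apply: eq_bigr => u _; rewrite mulrA.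
Qed.

Lemma lin_eval_lin c t f g :
  lin_eval c (fun x => t * f x + g x) = t * lin_eval c f + lin_eval c g.
Proof.
rewrite /lin_eval mulr_sumr -big_split/=; apply: eq_bigr => u _.
by rewrite mulrDr mulrCA.
Qed.

Lemma eq_lin_eval c f g : f =1 g -> lin_eval c f = lin_eval c g.
Proof. by move=> fg; apply: eq_bigr => u _; rewrite fg. Qed.

Lemma lin_eval1 t x f : lin_eval [:: (t, x)] f = t * f x.
Proof. by rewrite /lin_eval big_seq1. Qed.

Lemma kformC K c d : (forall x y, K x y = K y x) -> kform K c d = kform K d c.
Proof.
move=> KC; rewrite /kform /lin_eval.
under eq_bigr do rewrite mulr_sumr.
rewrite exchange_big/=; apply: eq_bigr => u _; rewrite mulr_sumr.
by apply: eq_bigr => v _; rewrite KC mulrCA.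
Qed.

Lemma kform_catl K c c' d : kform K (c ++ c') d = kform K c d + kform K c' d.
Proof. exact: lin_eval_cat. Qed.

Lemma kform_catr K c d d' : kform K c (d ++ d') = kform K c d + kform K c d'.
Proof.
rewrite -[kform K c d]mul1r -lin_eval_lin; apply: eq_lin_eval => x.
by rewrite lin_eval_cat mul1r.
Qed.

Lemma kform_scalel K t c d : kform K (scale_seq t c) d = t * kform K c d.
Proof. exact: lin_eval_scale. Qed.

Lemma kform_scaler K t c d : kform K c (scale_seq t d) = t * kform K c d.
Proof.
rewrite -[RHS]addr0.
have <- : lin_eval c (fun=> 0) = 0.
  by rewrite /lin_eval big1// => u _; rewrite mulr0.
rewrite -lin_eval_lin; apply: eq_lin_eval => x.
by rewrite lin_eval_scale addr0.
Qed.

Lemma kform_lin K K' t c d :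
  kform (fun x y => t * K x y + K' x y) c d = t * kform K c d + kform K' c d.
Proof.
by rewrite /kform -lin_eval_lin; apply: eq_lin_eval => x; rewrite lin_eval_lin.
Qed.

Lemma kform_prod f g c d :
  kform (fun x y => f x * g y) c d = lin_eval c f * lin_eval d g.
Proof.
rewrite /kform /lin_eval mulr_suml; apply: eq_bigr => u _.
by rewrite -mulrA !mulr_sumr; apply: eq_bigr => v _; congr (_ * _); exact: mulrCA.
Qed.

Lemma eq_kform K K' c d : (forall x y, K x y = K' x y) ->
  kform K c d = kform K' c d.
Proof.
by move=> KK'; apply: eq_lin_eval => x; apply: eq_lin_eval => y.
Qed.

Lemma cvg_lin_eval T (F : set_system T) (FF : Filter F) (f : T -> X -> R)
    (l : X -> R) c :
  (forall x, (fun t => f t x) @ F --> l x) ->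
  (fun t => lin_eval c (f t)) @ F --> lin_eval c l.
Proof.
move=> Fl; elim: c => [|u c IHc].
  have -> : (fun t => lin_eval [::] (f t)) = fun=> 0.
    by apply/funext => t; exact: big_nil.
  by rewrite /lin_eval big_nil; exact: cvg_cst.
have -> : (fun t => lin_eval (u :: c) (f t)) =
    (fun t => u.1 * f t u.2 + lin_eval c (f t)).
  by apply/funext => t; exact: big_cons.
rewrite /lin_eval big_cons; apply: cvgD => //.
by apply: cvgM => //; exact: cvg_cst.
Qed.

Record psdKernel := PsdKernel {
  kernel_fun :> X -> X -> R;
  kernel_psd : psd_kernel kernel_fun }.

Section Space.
Variable K : psdKernel.

Let KC := (kernel_psd K).1.
Let K0 := (kernel_psd K).2.

(** The supremum over [c] is the squared norm of [f] in the space with reproducing kernel [K]: a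
    bound [M] on it amounts to [f(c)^2 <= M K(c, c)]. The Hilbert space thus consists of functions
    on [X], with neither a quotient nor a completion. *)
Definition defect f c := 2 * lin_eval c f - kform K c c.

Definition bounded_functional f := exists M, forall c, defect f c <= M.

Lemma defect_scale t f c :
  defect f (scale_seq t c) = 2 * t * lin_eval c f - t ^+ 2 * kform K c c.
Proof. by rewrite /defect lin_eval_scale kform_scalel kform_scaler; lra. Qed.

(* The rescaling c -> t^-1 c turns 2 t f - k into t^2 (2 f - k). *)
Lemma defectZ t f c M : (forall c, defect f c <= M) ->
  defect (t *: f) c <= t ^+ 2 * M.
Proof.
move=> fM; rewrite /defect.
have -> : lin_eval c (t *: f) = t * lin_eval c f.
  rewrite -lin_eval_scale /lin_eval big_map; apply: eq_bigr => u _ /=.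
  by rewrite mulrCA mulrA.
have [->|t0] := eqVneq t 0; first by have := K0 c; lra.
have := fM (scale_seq t^-1 c); rewrite defect_scale => h.
have t2 : 0 < t ^+ 2 by rewrite exprn_even_gt0.
move: h; rewrite -(ler_pM2l t2); apply: le_trans.
by rewrite le_eqVlt; apply/orP; left; apply/eqP; field.
Qed.

Lemma lin_evalD c f g : lin_eval c (f + g) = lin_eval c f + lin_eval c g.
Proof.
rewrite -[lin_eval c f]mul1r -lin_eval_lin; apply: eq_lin_eval => x.
by rewrite mul1r.
Qed.

Lemma lin_evalN c f : lin_eval c (- f) = - lin_eval c f.
Proof. by rewrite /lin_eval -sumrN; apply: eq_bigr => u _; rewrite mulrN. Qed.

(** Test [f] on [(c + d) / 2] and [g] on [(c - d) / 2]: the mixed terms [K(c, d)] cancel in the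
    sum. *)
Lemma defect_parallelogram f g c d Mf Mg :
  (forall c, defect f c <= Mf) -> (forall c, defect g c <= Mg) ->
  defect (f + g) c + defect (f - g) d <= 2 * Mf + 2 * Mg.
Proof.
move=> fM gM.
have := fM (scale_seq 2^-1 (c ++ d)).
have := gM (scale_seq 2^-1 (c ++ scale_seq (-1) d)).
rewrite !defect_scale /defect !kform_catl !kform_catr !lin_eval_cat.
rewrite !kform_scalel !kform_scaler !lin_eval_scale !lin_evalD lin_evalN.
rewrite (kformC d c KC) => h1 h2; lra.
Qed.

Lemma bounded_functional_submod :
  submod_closed [pred f | `[< bounded_functional f >]].
Proof.
have sc t f : bounded_functional f -> bounded_functional (t *: f).
  by move=> [M fM]; exists (t ^+ 2 * M) => c; exact: defectZ.
have dc f g : bounded_functional f -> bounded_functional g ->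
    bounded_functional (f + g).
  move=> [M fM] [M' gM]; exists (2 * M + 2 * M') => c.
  have := defect_parallelogram c [::] fM gM.
  by rewrite /defect /kform /lin_eval !big_nil; lra.
split=> [|t f g].
  apply/asboolP; exists 0 => c; rewrite /defect /lin_eval big1 ?mulr0 ?sub0r.
    by rewrite oppr_le0.
  by move=> u _; rewrite mulr0.
by move=> /asboolP /(sc t) fB /asboolP gB; apply/asboolP; exact: dc.
Qed.

Definition rkhs_pred := [pred f : X -> R | `[< bounded_functional f >]].
HB.instance Definition _ := GRing.isSubmodClosed.Build _ _ rkhs_pred
  bounded_functional_submod.

Record rkhs := Rkhs { rkhs_val :> X -> R; _ : rkhs_val \in rkhs_pred }.
HB.instance Definition _ := [isSub for rkhs_val].
HB.instance Definition _ := [Choice of rkhs by <:].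
HB.instance Definition _ := [SubChoice_isSubLmodule of rkhs by <:].


Implicit Types v w : rkhs.

Definition sqnorm v : R := sup (range (defect v)).

Lemma defect_le_sqnorm v c : defect v c <= sqnorm v.
Proof.
apply: ub_le_sup; last by exists c.
by have /asboolP[M vM] := valP v; exists M => _ [d _ <-].
Qed.

Lemma sqnorm_le v M : (forall c, defect v c <= M) -> sqnorm v <= M.
Proof.
move=> vM; apply: ge_sup; first by exists (defect v [::]), [::].
by move=> _ [d _ <-].
Qed.

Lemma sqnorm_ge0 v : 0 <= sqnorm v.
Proof.
have := defect_le_sqnorm v [::].
by rewrite /defect /kform /lin_eval !big_nil mulr0 subr0.
Qed.

Lemma sqnormZ t v : sqnorm (t *: v) = t ^+ 2 * sqnorm v.
Proof.
have le s w : sqnorm (s *: w) <= s ^+ 2 * sqnorm w.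
  by apply: sqnorm_le => c; apply: defectZ => d; exact: defect_le_sqnorm.
apply/eqP; rewrite eq_le le/=; have [->|t0] := eqVneq t 0.
  by rewrite expr0n mul0r sqnorm_ge0.
have t2 : 0 < t ^+ 2 by rewrite exprn_even_gt0.
rewrite -ler_pdivlMl// -exprVn.
by apply: le_trans (le _ _); rewrite scalerA mulVf// scale1r.
Qed.

(** The inequality given by [defect_parallelogram], applied to [v + w] and [v - w], is its own
    converse. *)
Lemma sqnorm_parallelogram v w :
  sqnorm (v + w) + sqnorm (v - w) = 2 * sqnorm v + 2 * sqnorm w.
Proof.
have le x y : sqnorm (x + y) + sqnorm (x - y) <= 2 * sqnorm x + 2 * sqnorm y.
  rewrite -lerBrDr; apply: sqnorm_le => c; rewrite lerBrDr addrC -lerBrDr.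
  apply: sqnorm_le => d; rewrite lerBrDr addrC.
  by apply: defect_parallelogram => e; exact: defect_le_sqnorm.
apply/eqP; rewrite eq_le le/=.
have := le (v + w) (v - w).
have -> : v + w + (v - w) = 2 *: v by rewrite addrACA subrr addr0 scaler_nat.
have -> : v + w - (v - w) = 2 *: w.
  by rewrite opprB addrC addrA subrK scaler_nat.
by rewrite !sqnormZ; lra.
Qed.

Lemma lin_eval_sqr_le v c : lin_eval c v ^+ 2 <= sqnorm v * kform K c c.
Proof.
apply: sqr_le_mul => [||s]; [exact: sqnorm_ge0|exact: K0|].
by rewrite -defect_scale defect_le_sqnorm.
Qed.

Definition rkhs_norm v : R := Num.sqrt (sqnorm v).

Lemma rkhs_normD v w : rkhs_norm (v + w) <= rkhs_norm v + rkhs_norm w.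
Proof.
exact: (sqrtN_triangle sqnorm_ge0 sqnormZ sqnorm_parallelogram).
Qed.

Lemma rkhs_normZ t v : rkhs_norm (t *: v) = `|t| * rkhs_norm v.
Proof. by rewrite /rkhs_norm sqnormZ sqrtrM ?sqr_ge0// sqrtr_sqr. Qed.

Lemma sqnorm0_eq0 v : sqnorm v = 0 -> v = 0.
Proof.
move=> v0; apply/val_inj/funext => x.
have := lin_eval_sqr_le v [:: (1, x)]; rewrite v0 mul0r lin_eval1 mul1r.
move=> h; have /eqP : v x ^+ 2 = 0 by apply/eqP; rewrite eq_le h sqr_ge0.
by rewrite sqrf_eq0 => /eqP.
Qed.

Lemma rkhs_norm0_eq0 v : rkhs_norm v = 0 -> v = 0.
Proof.
move=> /eqP; rewrite sqrtr_eq0 => v0; apply: sqnorm0_eq0.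
by apply/eqP; rewrite eq_le v0 sqnorm_ge0.
Qed.

HB.instance Definition _ := Lmodule_isNormed.Build R rkhs
  rkhs_normD rkhs_normZ rkhs_norm0_eq0.

Lemma rkhs_normE v : `|v| = Num.sqrt (sqnorm v).
Proof. by []. Qed.

Lemma rkhs_sqr_normE v : `|v| ^+ 2 = sqnorm v.
Proof. by rewrite rkhs_normE sqr_sqrtr// sqnorm_ge0. Qed.

Definition rkhs_dot : rkhs -> rkhs -> R := polar sqnorm.

Lemma rkhs_dotC v w : rkhs_dot v w = rkhs_dot w v.
Proof. exact: (polarC sqnormZ). Qed.

Lemma rkhs_dot_bilinear : bilinear_for
  (GRing.Scale.Law.clone _ _ ( *%R ) _)
  (GRing.Scale.Law.clone _ _ (@idfun R \; *%R ) _)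
  rkhs_dot.
Proof.
have lin w : GRing.linear_for *%R (rkhs_dot ^~ w).
  move=> t x y; rewrite /rkhs_dot (polarDl sqnormZ sqnorm_parallelogram).
  by rewrite (polarZl sqnorm_ge0 sqnormZ sqnorm_parallelogram).
split=> // v t x y /=.
by rewrite rkhs_dotC lin 2!(rkhs_dotC _ v).
Qed.

HB.instance Definition _ := bilinear_isBilinear.Build R _ _ _
  (GRing.Scale.Law.clone _ _ ( *%R ) _)
  (GRing.Scale.Law.clone _ _ (@idfun R \; *%R ) _)
  rkhs_dot rkhs_dot_bilinear.

Lemma rkhs_dot_hermitian v w :
  rkhs_dot v w = (-1) ^+ false * idfun (rkhs_dot w v).
Proof. by rewrite mul1r rkhs_dotC. Qed.

HB.instance Definition _ := isHermitianSesquilinear.Build R rkhs false idfun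
  rkhs_dot rkhs_dot_hermitian.

Lemma rkhs_dot_gt0 v : v != 0 -> 0 < rkhs_dot v v.
Proof.
move=> v0; rewrite /rkhs_dot (polarxx sqnormZ) lt0r sqnorm_ge0 andbT.
by apply: contra_neq v0; exact: sqnorm0_eq0.
Qed.

HB.instance Definition _ := isDotProduct.Build R rkhs rkhs_dot rkhs_dot_gt0.

Lemma rkhs_norm_dot v : `|v| ^+ 2 = rkhs_dot v v.
Proof. by rewrite rkhs_sqr_normE /rkhs_dot (polarxx sqnormZ). Qed.

(** The limit is taken pointwise, since evaluations are Lipschitz by [lin_eval_sqr_le]. Each
    [defect] involves finitely many values, so the Cauchy bound on the defects of [v - w] survives
    when [w] tends to the limit. *)
Lemma rkhs_complete (F : set_system rkhs) :
  ProperFilter F -> cauchy F -> cvg F.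
Proof.
move=> FF /cauchy_ballP Fc.
have lP x : cvg ((v : rkhs) x @[v --> F]).
  apply: cauchy_cvg; apply/cauchy_ballP => e e0.
  pose k := Num.sqrt (K x x) + 1.
  have k0 : 0 < k by rewrite ltr_wpDl// sqrtr_ge0.
  have {}Fc := Fc (e / k) (divr_gt0 e0 k0).
  have Kx0 : 0 <= K x x.
    by have := K0 [:: (1, x)]; rewrite /kform !lin_eval1 !mul1r.
  move: Fc => [[A B] /= [FA FB] AB].
  exists ((fun v : rkhs => v x) @` A, (fun v : rkhs => v x) @` B).
    by split; [apply: filterS FA|apply: filterS FB] => v Av; exists v.
  move=> [_ _] /= [[v Av <-] [w Bw <-]].
  have := AB (v, w) (conj Av Bw); rewrite -!ball_normE /ball_/= => vw.
  have : `|(v - w) x| <= `|v - w| * Num.sqrt (K x x).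
    have := lin_eval_sqr_le (v - w) [:: (1, x)].
    rewrite /kform !lin_eval1 !mul1r rkhs_normE -sqrtrM ?sqnorm_ge0// => h.
    by rewrite -sqrtr_sqr ler_wsqrtr.
  move=> /le_lt_trans; apply.
  rewrite (@le_lt_trans _ _ (`|v - w| * k))//.
    by rewrite ler_wpM2l// lerDl.
  by rewrite -ltr_pdivlMr.
pose l x := lim ((v : rkhs) x @[v --> F]).
have Fl x : (v : rkhs) x @[v --> F] --> l x by exact: lP.
have near_l (e : R) : 0 < e ->
    \forall v \near F, forall c, defect (val v - l) c <= e ^+ 2.
  move=> e0; have [[A B] /= [FA FB] AB] := Fc e e0.
  apply: filterS FA => v Av c.
  have cv : defect (val v - val w) c @[w --> F] --> defect (val v - l) c.
    rewrite /defect; apply: cvgB; last exact: cvg_cst.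
    apply: cvgM; first exact: cvg_cst.
    have -> : (fun w : rkhs => lin_eval c (val v - val w)) =
        (fun w : rkhs => lin_eval c (val v) - lin_eval c w).
      by apply/funext => w; rewrite lin_evalD lin_evalN.
    rewrite lin_evalD lin_evalN.
    apply: cvgB; [exact: cvg_cst|exact: (@cvg_lin_eval _ _ _ rkhs_val)].
  apply: cvgr_to_le cv _; apply: filterS FB => w Bw.
  have := AB (v, w) (conj Av Bw); rewrite -ball_normE /ball_/= => vw.
  rewrite (le_trans (defect_le_sqnorm (v - w) c))// -rkhs_sqr_normE.
  by rewrite lerXn2r ?nnegrE// ltW.
have lB : l \in rkhs_pred.
  have [v vl] := filter_ex (near_l 1 ltr01).
  have -> : l = val v - (val v - l) by rewrite opprB addrC subrK.
  by apply: rpredB; [exact: valP|apply/asboolP; exists (1 ^+ 2)].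
apply/cvg_ex; exists (Rkhs lB); apply/cvgrPdist_le => /= e e0.
apply: filterS (near_l e e0) => v vl.
rewrite distrC rkhs_normE -[leRHS](ger0_norm (ltW e0)) -sqrtr_sqr ler_wsqrtr//.
exact: sqnorm_le.
Qed.

HB.instance Definition _ := Uniform_isComplete.Build rkhs rkhs_complete.

End Space.
End ReproducingKernel.

(** * From positive definite functions to affine actions *)

Section AffineAction.
Variables (R : realType) (G : groupType) (psi : G -> R).
Hypothesis psi1 : psi 1%g = 0.
Hypothesis psiV : forall g, psi g^-1%g = psi g.

(* The inner product of the points g and h, based at 1, of an embedding of G into
   a Hilbert space with squared distances psi (g^-1 h). *)
Definition gromov_kernel (g h : G) : R := (psi g + psi h - psi (g^-1 * h)%g) / 2.

Hypothesis gromov_psd : psd_kernel gromov_kernel.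

Let K : psdKernel R G := PsdKernel gromov_psd.

(** The linear part of the action: left translation, corrected by a constant so that the value at 1
    stays 0. *)
Definition cocycle_shift (g : G) (f : G -> R) (h : G) : R :=
  f (g^-1 * h)%g - f g^-1%g.

Definition seq_shift (g : G) (c : seq (R * G)) : seq (R * G) :=
  [seq (u.1, g^-1 * u.2)%g | u <- c] ++ [seq (- u.1, g^-1)%g | u <- c].

Lemma lin_eval_shift g c f :
  lin_eval c (cocycle_shift g f) = lin_eval (seq_shift g c) f.
Proof.
rewrite lin_eval_cat /lin_eval !big_map -big_split/=.
by apply: eq_bigr => u _; rewrite mulrBr mulNr.
Qed.

(** The kernel is an inner product based at 1. Subtracting the values at [g^-1] moves the base
    point, and the squared distances [psi (x^-1 y)] are left invariant. *)
Lemma kform_shift g c : kform K (seq_shift g c) (seq_shift g c) = kform K c c.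
Proof.
rewrite /kform -lin_eval_shift; apply: eq_lin_eval => x.
rewrite /cocycle_shift -mulN1r addrC -lin_eval_lin -lin_eval_shift.
apply: eq_lin_eval => y.
rewrite /cocycle_shift/= /gromov_kernel !invgM !invgK.
rewrite !mulgA !mulgK !mulgV !mul1g psi1 !psiV.
lra.
Qed.

Lemma defect_shift g f c :
  defect K (cocycle_shift g f) c = defect K f (seq_shift g c).
Proof. by rewrite /defect lin_eval_shift kform_shift. Qed.

Lemma shift_rkhs g (v : rkhs K) : cocycle_shift g v \in rkhs_pred K.
Proof.
have /asboolP[M vM] := valP v; apply/asboolP; exists M => c.
by rewrite defect_shift.
Qed.

Definition rkhs_shift g v : rkhs K := Rkhs (shift_rkhs g v).

Lemma rkhs_shift_linear g : linear (rkhs_shift g).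
Proof.
move=> t v w; apply/val_inj/funext => h.
change (t * v (g^-1 * h)%g + w (g^-1 * h)%g - (t * v g^-1%g + w g^-1%g) =
  t * (v (g^-1 * h)%g - v g^-1%g) + (w (g^-1 * h)%g - w g^-1%g)).
lra.
Qed.

HB.instance Definition _ g := GRing.isLinear.Build R (rkhs K) (rkhs K) _
  (rkhs_shift g) (rkhs_shift_linear g).

Lemma rkhs_at1 (v : rkhs K) : v 1%g = 0.
Proof.
have := lin_eval_sqr_le v [:: (1, 1%g)].
rewrite /kform !lin_eval1 !mul1r /= /gromov_kernel invg1 mulg1 psi1.
rewrite addrK mul0r mulr0 => h; have /eqP : v 1%g ^+ 2 = 0.
  by apply/eqP; rewrite eq_le h sqr_ge0.
by rewrite sqrf_eq0 => /eqP.
Qed.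

Lemma rkhs_shiftK g : cancel (rkhs_shift g) (rkhs_shift g^-1%g).
Proof.
move=> v; apply/val_inj/funext => h /=.
rewrite /cocycle_shift invgK mulKg mulVg rkhs_at1; lra.
Qed.

Lemma rkhs_shift_isometry g v : `|rkhs_shift g v| = `|v|.
Proof.
have le h w : `|rkhs_shift h w| <= `|w|.
  rewrite !rkhs_normE ler_wsqrtr//; apply: sqnorm_le => c.
  by rewrite defect_shift defect_le_sqnorm.
by apply/eqP; rewrite eq_le le/= -{1}(rkhs_shiftK g v) le.
Qed.

(** Positivity of the kernel on [c] minus the point mass at [g] is the required bound on the
    defect. *)
Lemma kernel_point_rkhs g : gromov_kernel g \in rkhs_pred K.
Proof.
apply/asboolP; exists (gromov_kernel g g) => c.
have := gromov_psd.2 ((-1, g) :: c).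
rewrite -cat1s !kform_catl !kform_catr (kformC c _ gromov_psd.1).
have -> : kform gromov_kernel [:: (-1, g)] c = - lin_eval c (gromov_kernel g).
  by rewrite /kform lin_eval1 mulN1r.
have -> : kform gromov_kernel [:: (-1, g)] [:: (-1, g)] = gromov_kernel g g.
  by rewrite /kform !lin_eval1 !mulN1r opprK.
by rewrite /defect /=; lra.
Qed.

Definition kernel_point g : rkhs K := Rkhs (kernel_point_rkhs g).

Lemma le_sqnorm_kernel_point g : psi g <= sqnorm (kernel_point g).
Proof.
have := defect_le_sqnorm (kernel_point g) [:: (1, g)].
rewrite /defect /kform !lin_eval1 /= /gromov_kernel mulVg psi1; lra.
Qed.

Definition affine_act g (v : rkhs K) : rkhs K := rkhs_shift g v + kernel_point g.

Lemma affine_act1 v : affine_act 1%g v = v.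
Proof.
apply/val_inj/funext => h; rewrite -[LHS]/(_ + _) /= /cocycle_shift.
by rewrite /gromov_kernel invg1 !mul1g psi1 rkhs_at1; lra.
Qed.

Lemma affine_actM g h v :
  affine_act (g * h)%g v = affine_act g (affine_act h v).
Proof.
apply/val_inj/funext => k.
change (v ((g * h)^-1 * k)%g - v (g * h)^-1%g + gromov_kernel (g * h)%g k =
  v (h^-1 * (g^-1 * k))%g - v h^-1%g + gromov_kernel h (g^-1 * k)%g -
  (v (h^-1 * g^-1)%g - v h^-1%g + gromov_kernel h g^-1%g) + gromov_kernel g k).
rewrite /gromov_kernel !invgM !mulgA.
have := psiV (h^-1 * g^-1)%g; rewrite invgM !invgK psiV; lra.
Qed.

Hypothesis psi_proper : forall C, finite_set [set g | psi g <= C].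

(** The image of 0 under [affine_act g] is [kernel_point g], of squared norm at least [psi g]. If
    [g] moves some point of a ball of radius [M + 1] into that ball, the norm is at most
    [2 (M + 1)]. *)
Lemma proper_cnd_haagerup : haagerup R G.
Proof.
exists (rkhs K), (@rkhs_dot R G K), affine_act.
have diff g v w : affine_act g v - affine_act g w = rkhs_shift g (v - w).
  by rewrite /affine_act linearB/= opprD addrACA subrr addr0.
split; first exact: rkhs_norm_dot.
split; [exact: affine_act1|exact: affine_actM| | |].
- by move=> g; exists (rkhs_shift g), (kernel_point g).
- by move=> g v w; rewrite diff rkhs_shift_isometry.
move=> B [M [_ /(_ (M + 1))]]; rewrite ltrDl ltr01 => /(_ isT) BM.
apply: sub_finite_set (psi_proper ((2 * (M + 1)) ^+ 2)) => g /= [_ [[v Bv <-]]].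
move=> /BM/= gv; rewrite (le_trans (le_sqnorm_kernel_point g))//.
have -> : kernel_point g = affine_act g v - rkhs_shift g v.
  by rewrite /affine_act addrAC subrr add0r.
rewrite -rkhs_sqr_normE lerXn2r ?nnegrE ?normr_ge0//.
  by have := normr_ge0 (affine_act g v); have := BM _ Bv => /=; lra.
rewrite (le_trans (ler_normB _ _))// rkhs_shift_isometry.
by have := BM _ Bv => /=; lra.
Qed.

End AffineAction.

Section ApproximateUnit.
Variables (R : realType) (G : groupType).

Lemma psd_unit_bound (P : G -> R) :
  psd_kernel (fun x y => P (x^-1 * y)%g) -> P 1%g = 1 ->
  forall g, P g^-1%g = P g /\ -1 <= P g <= 1.
Proof.
move=> [PC P0] P1 g.
have PV : P g^-1%g = P g by have := PC g 1%g; rewrite mulg1 invg1 mul1g.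
have P2 t : 0 <= 1 + 2 * t * P g + t ^+ 2.
  have := P0 [:: (1, 1%g); (t, g)].
  rewrite /kform /lin_eval !big_cons !big_nil /=.
  by rewrite invg1 !mulVg !mul1g mulg1 PV P1; lra.
split=> //; have := P2 1; have := P2 (-1); lra.
Qed.

(** Take for [psi] the sum of the [1 - P n], where [P n] is at least [1 - 2^-n] on the first [n]
    elements of the enumeration. If [psi g <= C], one of the first [N > 2 |C|] functions exceeds 1/2
    at [g], which leaves finitely many [g]. *)
Lemma haagerup_approximate_unit (u : nat -> G) :
  (forall g, exists n, u n = g) ->
  (forall (k : seq G) (e : R), 0 < e -> exists P : G -> R,
    [/\ psd_kernel (fun x y => P (x^-1 * y)%g), P 1%g = 1,
        forall g, g \in k -> 1 - e <= P g
      & finite_set [set g | 2^-1 < P g]]) ->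
  haagerup R G.
Proof.
move=> u_surj approx.
have /choice[P HP] : forall n, exists P : G -> R,
    [/\ psd_kernel (fun x y => P (x^-1 * y)%g), P 1%g = 1,
        forall i, (i < n)%N -> 1 - 2^-1 ^+ n <= P (u i)
      & finite_set [set g | 2^-1 < P g]].
  move=> n; have e0 : 0 < (2^-1 : R) ^+ n by rewrite exprn_gt0// invr_gt0.
  have [P [Pp P1 Pu Pf]] := approx [seq u i | i <- iota 0 n] _ e0.
  exists P; split=> // i ni; apply: Pu; apply/mapP; exists i => //.
  by rewrite mem_iota.
have Pb n g : P n g^-1%g = P n g /\ -1 <= P n g <= 1.
  by have [Pp P1 _ _] := HP n; exact: psd_unit_bound.
pose D g n := 1 - P n g.
have D0 g n : 0 <= D g n by rewrite subr_ge0; have [_ /andP[]] := Pb n g.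
have cvD g : cvgn (series (D g)).
  have [i <-] := u_surj g.
  (* For [n > i] the term at [u i] is at most [2^-n]; for the earlier ones only the bound 2 is
     known, and the factor [2^(i+1)] absorbs it. *)
  apply: (@series_le_cvg _ _ (geometric (2 ^+ i.+1) 2^-1)) => // [n|n|].
  - by rewrite /geometric/= mulr_ge0// exprn_ge0// invr_ge0.
  - rewrite /geometric/= /D; have [ni|ni] := leqP n i.
      have -> : (2 : R) ^+ i.+1 * 2^-1 ^+ n = 2 * 2 ^+ (i - n).
        by rewrite exprVn -exprS -subSn// expfB_cond ?pnatr_eq0//
          -?exprB ?unitfE// ?(leq_trans ni)//.
      have h : (1 : R) <= 2 ^+ (i - n) by rewrite exprn_ege1// ler1n.
      have [_ /andP[]] := Pb n (u i); lra.
    have [_ _ /(_ i ni) h _] := HP n.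
    have h1 : (1 : R) <= 2 ^+ i.+1 by rewrite exprn_ege1// ler1n.
    have h2 : (0 : R) <= 2^-1 ^+ n by rewrite exprn_ge0// invr_ge0.
    by rewrite (@le_trans _ _ (2^-1 ^+ n))//; [lra|rewrite ler_peMl].
  - by apply: is_cvg_geometric_series; rewrite ger0_norm ?invr_ge0// invf_lt1// ltr1n.
pose psi g := limn (series (D g)).
have psi_cvg g : series (D g) @ \oo --> psi g by exact: cvD.
have psi_series g N : series (D g) N <= psi g.
  apply: nondecreasing_cvgn_le => //.
  by apply/nondecreasing_seqP => n; rewrite seriesSr lerDl.
apply: (@proper_cnd_haagerup _ _ psi).
- rewrite /psi (_ : series _ = fun=> 0) ?lim_cst//.
  apply/funext => N; rewrite /series/= big1// => n _.
  by rewrite /D; have [_ -> _ _] := HP n; rewrite subrr.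
- by move=> g; congr (limn (series _)); apply/funext => n; rewrite /D (Pb n g).1.
- pose k N g h := (series (D g) N + series (D h) N - series (D (g^-1 * h)%g) N) / 2.
  have kcvg g h : k N g h @[N --> \oo] --> gromov_kernel psi g h.
    by apply: cvgM; [apply: cvgB => //; exact: cvgD|exact: cvg_cst].
  split=> [g h|c].
    rewrite /gromov_kernel [psi g + _]addrC; congr ((_ - _) / _).
    rewrite -[(g^-1 * h)%g]invgK invgM invgK.
    by congr (limn (series _)); apply/funext => n; rewrite /D (Pb n _).1.
  have : (fun N => kform (k N) c c) @ \oo --> kform (gromov_kernel psi) c c.
    by apply: cvg_lin_eval => x; apply: cvg_lin_eval => y; exact: kcvg.
  move=> /cvgr_to_ge; apply; apply: nearW => N.
  elim: N => [|N IHN].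
    rewrite /kform /lin_eval big1// => v _; rewrite big1 ?mulr0// => w _.
    by rewrite /k /series/= !big_nil; lra.
  pose t : R := lin_eval c (fun=> 1).
  have [[PC PP] P1 _ _] := HP N.
  (* As [t] is the total mass of [c], this combination has mass 0; the kernel of [P N] on it is
     twice the increment from [k N] to [k N.+1]. *)
  have := PP ((- t, 1%g) :: c).
  have -> : kform (k N.+1) c c = kform (k N) c c + 2^-1 *
      (t ^+ 2 - 2 * t * lin_eval c (P N) + kform (fun x y => P N (x^-1 * y)%g) c c).
    pose one (x : G) : R := 1.
    rewrite (_ : kform (k N.+1) c c = kform (fun x y =>
      2^-1 * (-1 * (P N x * one y) + (-1 * (one x * P N y) +
        (1 * (one x * one y) + P N (x^-1 * y)%g))) + k N x y) c c); last first.
      by apply: eq_kform => x y; rewrite /k /one !seriesSr /D; lra.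
    rewrite !kform_lin !kform_prod -/t.
    lra.
  rewrite -cat1s !kform_catl !kform_catr.
  rewrite (kformC c [:: (- t, 1%g)]) //.
  rewrite /kform !lin_eval1 /= mulVg P1 -/(kform _ _ _).
  rewrite (eq_lin_eval _ (g := P N)); last by move=> y; rewrite invg1 mul1g.
  rewrite -/(kform _ c c); lra.
- move=> C; pose N := (Num.truncn (2 * `|C|)).+1.
  apply: (@sub_finite_set _ _ (\bigcup_(n in `I_N) [set g | 2^-1 < P n g])).
    move=> g /= gC; apply: contrapT => nP.
    have : N%:R * 2^-1 <= series (D g) N.
      rewrite mulr_natl -[N in _ *+ N]subn0 -sumr_const_nat.
      rewrite /series/= !big_mkord; apply: ler_sum => n _.
      rewrite /D lerBrDl -lerBrDr; apply: contrapT => /negP.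
      rewrite -ltNge => Pn; apply: nP; exists n => //=; lra.
    have C0 : 0 <= 2 * `|C| by rewrite mulr_ge0.
    have /andP[_] := truncn_itv C0; rewrite -/N.
    have := psi_series g N; have := ler_norm C; lra.
  by apply: bigcup_finite => // n _; have [_ _ _] := HP n.
Qed.
End ApproximateUnit.

(** * Constructions of positive definite kernels *)

Section KernelConstructions.
Variables (R : realType) (X : choiceType).
Implicit Types (K : X -> X -> R).

Lemma psd_cst1 : psd_kernel (fun _ _ : X => 1 : R).
Proof.
split=> // c; pose one (x : X) : R := 1.
rewrite (@eq_kform _ _ _ (fun x y => one x * one y)); last first.
  by move=> x y; rewrite mulr1.
by rewrite kform_prod -expr2 sqr_ge0.
Qed.

Lemma psd_scale K t : 0 <= t -> psd_kernel K -> psd_kernel (fun x y => t * K x y).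
Proof.
move=> t0 [KC K0]; split=> [x y|c]; first by rewrite KC.
rewrite (@eq_kform _ _ _ (fun x y => (t - 1) * K x y + K x y)); last first.
  by move=> x y; lra.
by rewrite kform_lin; have := mulr_ge0 t0 (K0 c); lra.
Qed.

Lemma psd_comp (Y : Type) (f : Y -> X) K : psd_kernel K ->
  psd_kernel (fun x y => K (f x) (f y)).
Proof.
move=> [KC K0]; split=> [x y|c]; first exact: KC.
have := K0 [seq (u.1, f u.2) | u <- c].
rewrite /kform /lin_eval big_map /=.
by under eq_bigr do rewrite big_map.
Qed.

(** Block diagonal along the fibres of [t]. The kernel may change from block to block, as
    [wall_kernel z] does with the coset [z]. *)
Lemma psd_fiber (V : eqType) (t : X -> V) (K : V -> X -> X -> R) :
  (forall v, psd_kernel (K v)) ->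
  psd_kernel (fun x y => if t x == t y then K (t x) x y else 0).
Proof.
move=> Kp; split=> [x y|c].
  by rewrite eq_sym; case: eqP => // ->; exact: (Kp _).1.
pose vs := undup [seq t u.2 | u <- c].
suff -> : kform (fun x y => if t x == t y then K (t x) x y else 0) c c =
    \sum_(v <- vs) kform (K v) [seq u <- c | t u.2 == v] [seq u <- c | t u.2 == v].
  by apply: sumr_ge0 => v _; exact: (Kp v).2.
rewrite /kform /lin_eval.
under [RHS]eq_bigr do rewrite big_filter big_mkcond/=.
rewrite exchange_big/= big_seq [RHS]big_seq; apply: eq_bigr => u uc.
rewrite -big_mkcond/= (eq_bigl (fun v => v == t u.2)); last first.
  by move=> v; rewrite eq_sym.
rewrite -[in RHS]big_filter filter_pred1_uniq ?undup_uniq//; last first.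
  by rewrite mem_undup; exact: (map_f (fun u => t u.2)).
rewrite big_seq1.
rewrite big_filter [in RHS]big_mkcond/=; congr (_ * _).
by apply: eq_bigr => w _; rewrite eq_sym; case: ifP; rewrite ?mulr0.
Qed.

(** With [K0] the part of [K] inside the fibres of [t], the kernel is [r K + (1 - r) K0]. *)
Lemma psd_wall (V : eqType) (t : X -> V) K (r : R) : 0 <= r <= 1 ->
  psd_kernel K ->
  psd_kernel (fun x y => (if t x == t y then 1 else r) * K x y).
Proof.
move=> /andP[r0 r1] [KC KP].
pose K0 x y := if t x == t y then K x y else 0.
have -> : (fun x y => (if t x == t y then 1 else r) * K x y) =
    (fun x y => r * (-1 * K0 x y + K x y) + K0 x y).
  by apply/funext => x; apply/funext => y; rewrite /K0; case: ifP => _; lra.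
have [K0C K0P] : psd_kernel K0
  by exact: (@psd_fiber _ t (fun=> K) (fun=> conj KC KP)).
split=> [x y|c]; first by rewrite K0C KC.
rewrite !kform_lin; have := mulr_ge0 r0 (KP c).
have : 0 <= (1 - r) * kform K0 c c by rewrite mulr_ge0 ?subr_ge0.
lra.
Qed.

Lemma psd_walls (I : Type) (V : eqType) (s : seq I) (t : I -> X -> V)
    (r : I -> R) : (forall i, 0 <= r i <= 1) ->
  psd_kernel (fun x y => \prod_(i <- s) if t i x == t i y then 1 else r i).
Proof.
move=> r01; elim: s => [|i s IHs].
  have -> : (fun x y => \prod_(i <- [::]) if t i x == t i y then 1 else r i) =
      (fun _ _ => 1 : R).
    by apply/funext => x; apply/funext => y; rewrite big_nil.
  exact: psd_cst1.
have -> : (fun x y => \prod_(i <- i :: s) if t i x == t i y then 1 else r i) =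
    (fun x y => (if t i x == t i y then 1 else r i) *
      \prod_(i <- s) if t i x == t i y then 1 else r i).
  by apply/funext => x; apply/funext => y; rewrite big_cons.
exact: psd_wall.
Qed.

(** Positivity is tested on finitely many points at a time. This serves [wall_kernel], whose walls
    are finite in number only once the points are fixed. *)
Lemma psd_local K :
  (forall s : seq X, exists2 K', psd_kernel K' &
     {in s &, forall x y, K x y = K' x y}) ->
  psd_kernel K.
Proof.
move=> loc; split=> [x y|c].
  have [K' [K'C _] KK'] := loc [:: x; y].
  by rewrite !KK' ?inE ?eqxx ?orbT.
have [K' [_ K'0] KK'] := loc [seq u.2 | u <- c].
suff -> : kform K c c = kform K' c c by [].
rewrite /kform /lin_eval !big_seq; apply: eq_bigr => u uc; congr (_ * _).
rewrite !big_seq; apply: eq_bigr => v vc; congr (_ * _).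
by apply: KK'; exact: map_f.
Qed.

End KernelConstructions.

(** Spread the coefficient of each [x] over all the points [(x, i)]. *)
Lemma psd_marginal (R : realType) (X : Type) (I : finType)
    (K : X * I -> X * I -> R) : psd_kernel K ->
  psd_kernel (fun x y => \sum_i \sum_j K (x, i) (y, j)).
Proof.
move=> [KC K0]; split=> [x y|c].
  by rewrite exchange_big/=; apply: eq_bigr => i _; apply: eq_bigr.
have := K0 [seq (u.1, (u.2, i)) | u <- c, i <- enum I].
suff -> : kform K [seq (u.1, (u.2, i)) | u <- c, i <- enum I]
    [seq (u.1, (u.2, i)) | u <- c, i <- enum I] =
    kform (fun x y => \sum_i \sum_j K (x, i) (y, j)) c c by [].
rewrite /kform /lin_eval big_allpairs_dep/=; apply: eq_bigr => u _.
rewrite big_enum/= -mulr_sumr; congr (_ * _).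
transitivity (\sum_i \sum_(v <- c) \sum_j v.1 * K (u.2, i) (v.2, j)).
  apply: eq_bigr => i _; rewrite big_allpairs_dep/=; apply: eq_bigr => v _.
  by rewrite big_enum.
rewrite exchange_big/=; apply: eq_bigr => v _.
by rewrite mulr_sumr; apply: eq_bigr => i _; rewrite mulr_sumr.
Qed.

(** * Bass-Serre trees of HNN extensions *)

(* The Bass-Serre tree of an HNN extension with base E and stable letter a:
   vertices are the cosets x E, and x stands for the edge from x E to x a E,
   which is also the edge of x e for e in the intersection of E and a E a^-1.
   That the graph is a tree enters through hnn_flow: every set D of edges is
   crossed algebraically hnn_flow D x times by each path from 1 to x. *)
Record hnn_splitting (G : groupType) := HNN {
  hnn_a : G;
  hnn_E : set G;
  hnn_flow : set G -> G -> int;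
  hnn_E1 : hnn_E 1%g;
  hnn_EV : forall x, hnn_E x -> hnn_E x^-1%g;
  hnn_EM : forall x y, hnn_E x -> hnn_E y -> hnn_E (x * y)%g;
  hnn_gen : forall P : set G, P 1%g ->
    (forall x e, P x -> hnn_E e -> P (x * e)%g) ->
    (forall x, P x -> P (x * hnn_a)%g) ->
    (forall x, P x -> P (x * hnn_a^-1)%g) -> forall x, P x;
  hnn_flow1 : forall D, hnn_flow D 1%g = 0;
  hnn_flow_a : forall D : set G,
    (forall x e, D x -> hnn_E e -> hnn_E (hnn_a^-1 * e * hnn_a)%g -> D (x * e)%g) ->
    forall x, hnn_flow D (x * hnn_a)%g = hnn_flow D x + `[< D x >]%:R;
  hnn_flow_E : forall D : set G,
    (forall x e, D x -> hnn_E e -> hnn_E (hnn_a^-1 * e * hnn_a)%g -> D (x * e)%g) ->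
    forall x e, hnn_E e -> hnn_flow D (x * e)%g = hnn_flow D x }.

Section Tree.
Variables (G : groupType) (T : hnn_splitting G).

Local Notation a := (hnn_a T).
Local Notation E := (hnn_E T).
Local Notation flow := (hnn_flow T).

Definition edge_stab (x : G) : Prop := E x /\ E (a^-1 * x * a)%g.

Definition edge_set (D : set G) : Prop :=
  forall x e, D x -> edge_stab e -> D (x * e)%g.

Lemma edge_stabM x y : edge_stab x -> edge_stab y -> edge_stab (x * y)%g.
Proof.
move=> [x1 x2] [y1 y2]; split; first exact: hnn_EM.
by have := hnn_EM x2 y2; rewrite !mulgA mulgK.
Qed.

Lemma edge_stabV x : edge_stab x -> edge_stab x^-1%g.
Proof.
move=> [x1 x2]; split; first exact: hnn_EV.
by have := hnn_EV x2; rewrite !invgM invgK mulgA.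
Qed.

Lemma edge_stab1 : edge_stab 1%g.
Proof. by split; rewrite ?mulg1 ?mulVg; exact: hnn_E1. Qed.

Lemma edge_setP D : edge_set D ->
  forall x e, D x -> E e -> E (a^-1 * e * a)%g -> D (x * e)%g.
Proof. by move=> DB x e Dx Ee Ea; exact: DB. Qed.

Lemma flow_a D x : edge_set D -> flow D (x * a)%g = flow D x + `[< D x >]%:R.
Proof. by move=> /edge_setP DB; exact: (@hnn_flow_a _ T D DB). Qed.

Lemma flow_E D x e : edge_set D -> E e -> flow D (x * e)%g = flow D x.
Proof. by move=> /edge_setP DB; exact: (@hnn_flow_E _ T D DB). Qed.

Lemma flow_eqE D x y : edge_set D -> E (x^-1 * y)%g -> flow D y = flow D x.
Proof. by move=> DB /(flow_E x DB); rewrite mulVKg. Qed.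

Lemma edge_set_translate D g : edge_set D -> edge_set [set y | D (g * y)%g].
Proof. by move=> DB x e /= Dx Be; rewrite mulgA; exact: DB. Qed.

(** A cocycle identity, by induction along the generators; the step for [a^-1] is the step for [a]
    read backwards. When [D] is invariant under a subgroup, the flow restricts to a homomorphism
    there. *)
Lemma flow_translate D g x : edge_set D ->
  flow D (g * x)%g = flow D g + flow [set y | D (g * y)%g] x.
Proof.
move=> DB; have DgB := @edge_set_translate D g DB.
move: x; apply: (@hnn_gen _ T [set x | flow D (g * x)%g =
  flow D g + flow [set y | D (g * y)%g] x]) => /= [|x e IHx Ee|x IHx|x IHx].
- by rewrite mulg1 hnn_flow1 addr0.
- by rewrite mulgA (flow_E _ DB Ee) (flow_E _ DgB Ee).
- by rewrite mulgA (flow_a _ DB) (flow_a _ DgB) IHx addrA.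
- have h1 := flow_a (x * a^-1)%g DgB; have h2 := flow_a (g * (x * a^-1))%g DB.
  rewrite mulgVK in h1; rewrite -[X in flow D X = _]mulgA mulgVK IHx h1 addrA in h2.
  by apply: (addIr _ (esym h2)).
Qed.

(** The step [(e, false)] crosses the edge [e] from [e E] to [e a E], and [(e, true)] crosses it
    backwards. *)
Definition step_src (s : G * bool) : G := if s.2 then (s.1 * a)%g else s.1.
Definition step_tgt (s : G * bool) : G := if s.2 then s.1 else (s.1 * a)%g.

Fixpoint tree_path (x : G) (l : seq (G * bool)) (y : G) : Prop :=
  if l is s :: l' then E (x^-1 * step_src s)%g /\ tree_path (step_tgt s) l' y
  else E (x^-1 * y)%g.

Lemma E_sym x y : E (x^-1 * y)%g -> E (y^-1 * x)%g.
Proof. by move=> /(@hnn_EV _ T); rewrite invgM invgK. Qed.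

Lemma E_trans y x z : E (x^-1 * y)%g -> E (y^-1 * z)%g -> E (x^-1 * z)%g.
Proof. by move=> xy /(hnn_EM xy); rewrite -mulgA mulVKg. Qed.

Lemma E_translate (g x y : G) : ((g * x)^-1 * (g * y) = x^-1 * y)%g.
Proof. by rewrite invgM -mulgA mulKg. Qed.

Lemma tree_path_src x x' l y :
  E (x'^-1 * x)%g -> tree_path x l y -> tree_path x' l y.
Proof.
case: l => [|s l] /= xx; first exact: E_trans xx.
by move=> [xs sl]; split=> //; exact: E_trans xx xs.
Qed.

Lemma tree_path_tgt x l y y' :
  E (y^-1 * y')%g -> tree_path x l y -> tree_path x l y'.
Proof.
move=> yy; elim: l x => [|s l IHl] x /=; first by move=> xy; exact: E_trans xy yy.
by move=> [xs /IHl].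
Qed.

Lemma tree_path_catP x l l' y : tree_path x (l ++ l') y <->
  exists2 z, tree_path x l z & tree_path z l' y.
Proof.
elim: l x => [|s l IHl] x /=.
  split=> [xy|[z xz zy]]; last exact: tree_path_src zy.
  by exists x => //; rewrite mulVg; exact: hnn_E1.
split=> [[xs /IHl[z sz zy]]|[z [xs sz] zy]]; first by exists z.
by split=> //; apply/IHl; exists z.
Qed.

Lemma tree_path_translate g x l y : tree_path x l y ->
  tree_path (g * x)%g [seq ((g * s.1)%g, s.2) | s <- l] (g * y)%g.
Proof.
have tr s : (step_src ((g * s.1)%g, s.2) = g * step_src s)%g /\
    (step_tgt ((g * s.1)%g, s.2) = g * step_tgt s)%g.
  by rewrite /step_src /step_tgt /=; case: s.2; rewrite ?mulgA.
elim: l x => [|s l IHl] x /=; first by rewrite E_translate.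
by rewrite (tr s).1 (tr s).2 E_translate => -[xs /IHl].
Qed.

Lemma tree_path_exists x y : exists l, tree_path x l y.
Proof.
suff from1 z : exists l, tree_path 1%g l z.
  have [l pl] := from1 (x^-1 * y)%g.
  exists [seq ((x * s.1)%g, s.2) | s <- l].
  by have := tree_path_translate x pl; rewrite mulg1 mulVKg.
move: z; apply: (@hnn_gen _ T [set z | exists l, tree_path 1%g l z]) => /=
  [|z e [l pl] Ee|z [l pl]|z [l pl]].
- by exists [::] => /=; rewrite mulVg; exact: hnn_E1.
- by exists l; apply: tree_path_tgt pl; rewrite mulKg.
- exists (l ++ [:: (z, false)]); apply/tree_path_catP; exists z => //=.
  by rewrite /step_src /step_tgt/= !mulVg; split; exact: hnn_E1.
- exists (l ++ [:: ((z * a^-1)%g, true)]); apply/tree_path_catP; exists z => //=.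
  by rewrite /step_src /step_tgt/= mulgVK !mulVg; split; exact: hnn_E1.
Qed.

Definition crossings (D : set G) (l : seq (G * bool)) : int :=
  \sum_(s <- l) (-1) ^+ s.2 * `[< D s.1 >]%:R.

Lemma flow_path D x l y : edge_set D -> tree_path x l y ->
  flow D y = flow D x + crossings D l.
Proof.
move=> DB; rewrite /crossings; elim: l x => [|s l IHl] x /=.
  by move=> /(flow_eqE DB) ->; rewrite big_nil addr0.
move=> [xs /IHl ->]; rewrite big_cons addrA; congr (_ + _).
move: xs; rewrite /step_src /step_tgt; case: s => e [] /= xs.
  by rewrite -(flow_eqE DB xs) flow_a// expr1 mulN1r addrK.
by rewrite flow_a// (flow_eqE DB xs) expr0 mul1r.
Qed.

Definition geodesic x l y : Prop :=
  tree_path x l y /\ forall l', tree_path x l' y -> (size l <= size l')%N.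

Lemma geodesic_exists x y : exists l, geodesic x l y.
Proof.
have ex : exists n, `[< exists2 l, tree_path x l y & size l = n >].
  by have [l pl] := tree_path_exists x y; exists (size l); apply/asboolP; exists l.
case: (ex_minnP ex) => n /asboolP[l pl ln] min_n.
exists l; split=> // l' pl'; rewrite ln; apply: min_n.
by apply/asboolP; exists l'.
Qed.

(* Otherwise the part of the path between the two steps could be cut out. *)
Lemma geodesic_edges x y l1 l2 l3 s t :
  geodesic x (l1 ++ s :: l2 ++ t :: l3) y -> ~ edge_stab (s.1^-1 * t.1)%g.
Proof.
move=> [pl pmin] [st1 st2]; move/tree_path_catP: pl => [z xz /= [zs]].
move=> /tree_path_catP[w sw /= [wt ty]].
have fst_eq : E (s.1^-1 * t.1)%g by [].
have snd_eq : E ((s.1 * a)^-1 * (t.1 * a))%g by rewrite invgM -!mulgA mulgA in st2 *.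
have src_tgt : s.2 = t.2 -> E ((step_src s)^-1 * step_src t)%g.
  by rewrite /step_src => ->; case: t.2.
have tgt_tgt : s.2 != t.2 -> E ((step_src s)^-1 * step_tgt t)%g.
  by rewrite /step_src /step_tgt; case: s.2; case: t.2.
have [e|e] := eqVneq s.2 t.2.
  suff /pmin : tree_path x (l1 ++ t :: l3) y.
    by rewrite !size_cat /= !size_cat /=; lia.
  apply/tree_path_catP; exists z => //=; split=> //.
  exact: E_trans (src_tgt e).
suff /pmin : tree_path x (l1 ++ l3) y.
  by rewrite !size_cat /= !size_cat /=; lia.
apply/tree_path_catP; exists z => //=.
by apply: tree_path_src ty; apply: E_trans (tgt_tgt e).
Qed.

Definition edge_coset (x : G) : set G := [set y | edge_stab (x^-1 * y)%g].

Lemma edge_coset_edge_set x : edge_set (edge_coset x).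
Proof. by move=> y e xy Be; rewrite /edge_coset/= mulgA; exact: edge_stabM. Qed.

Lemma edge_coset_self x : edge_coset x x.
Proof. by rewrite /edge_coset/= mulVg; exact: edge_stab1. Qed.

Lemma edge_coset_eq x y : edge_stab (x^-1 * y)%g -> edge_coset x = edge_coset y.
Proof.
move=> xy; rewrite /edge_coset; apply/seteqP; split=> z /= h.
  have := edge_stabM (edge_stabV xy) h.
  by rewrite invgM invgK -!mulgA mulVKg.
by have := edge_stabM xy h; rewrite -!mulgA mulVKg.
Qed.

Lemma geodesic_uniq x l y : geodesic x l y -> uniq [seq edge_coset s.1 | s <- l].
Proof.
move=> gl; rewrite -[uniq _]negbK; apply/negP => /(uniqPn set0)[i [j [ij]]].
rewrite size_map => jl.
have il := ltn_trans ij jl.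
rewrite !(nth_map (1%g, false))// => eqij.
set s := nth _ l i in eqij; set t := nth _ l j in eqij.
have dl : l = take i l ++ s :: take (j - i.+1) (drop i.+1 l) ++ t :: drop j.+1 l.
  have -> : t :: drop j.+1 l = drop (j - i.+1) (drop i.+1 l).
    by rewrite drop_drop subnK// -drop_nth.
  by rewrite cat_take_drop -drop_nth// cat_take_drop.
rewrite dl in gl; apply: (geodesic_edges gl).
by have := edge_coset_self t.1; rewrite -eqij.
Qed.

(** A geodesic crosses each of its edges exactly once, so the flow through that edge changes by a
    sign. With [flow_separated], every path with the same ends crosses that edge too. *)
Lemma geodesic_flow x l y s : geodesic x l y -> s \in l ->
  flow (edge_coset s.1) x != flow (edge_coset s.1) y.
Proof.
move=> gl sl; rewrite (flow_path (@edge_coset_edge_set s.1) gl.1).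
have -> : crossings (edge_coset s.1) l = (-1) ^+ s.2.
  have ul := geodesic_uniq gl.
  rewrite /crossings (big_rem s)//= big_seq big1 ?addr0.
    by rewrite (asboolT (edge_coset_self _)) mulr1.
  move=> t tl; suff nt : ~ edge_coset s.1 t.1 by rewrite asboolF// mulr0.
  move=> /edge_coset_eq st.
  have := perm_to_rem sl => /(perm_map (fun u => edge_coset u.1))/perm_uniq.
  rewrite ul /= st => /esym/andP[/negP nt _]; apply: nt.
  by apply/mapP; exists t.
by rewrite eq_sym -subr_eq0 addrAC subrr add0r signr_eq0.
Qed.

Lemma flow_separated x l y W : edge_set W -> tree_path x l y ->
  flow W x != flow W y -> exists2 s, s \in l & W s.1.
Proof.
move=> WB pl; apply: contra_neqP => nW.
rewrite (flow_path WB pl) /crossings big_seq big1 ?addr0// => s sl.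
suff nWs : ~ W s.1 by rewrite asboolF// mulr0.
by move=> Ws; apply: nW; exists s.
Qed.

End Tree.

(** * Marked groups and their quotients *)

Section Words.
Variables (k : nat) (G : groupType) (s : 'I_k -> G).

Lemma word_eval_nil : word_eval s [::] = 1%g.
Proof. exact: big_nil. Qed.

Lemma word_eval_cons c w : word_eval s (c :: w) =
  ((if c.2 then (s c.1)^-1 else s c.1) * word_eval s w)%g.
Proof. exact: big_cons. Qed.

Lemma word_eval_cat u v : word_eval s (u ++ v) = (word_eval s u * word_eval s v)%g.
Proof. exact: big_cat. Qed.

Lemma word_eval_inv w : word_eval s (inv_word w) = (word_eval s w)^-1%g.
Proof.
elim: w => [|c w IHw]; first by rewrite word_eval_nil invg1.
rewrite /inv_word map_cons rev_cons -cats1 word_eval_cat -/(inv_word w) IHw.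
rewrite !word_eval_cons word_eval_nil mulg1 invgM; congr (_ * _)%g.
by case: c => i [] /=; rewrite ?invgK.
Qed.

End Words.

Section SubgroupGen.
Variable G : groupType.
Implicit Types (A H : set G).

Lemma subgroup_genP A : is_subgroup (subgroup_gen A).
Proof.
split=> [H [[H1 _] _]//|x y Ax Ay H HA].
by apply: HA.1.2; [exact: Ax|exact: Ay].
Qed.

Lemma sub_subgroup_gen A : A `<=` subgroup_gen A.
Proof. by move=> x Ax H [_]; apply. Qed.

Lemma subgroup_gen_sub A H : is_subgroup H -> A `<=` H -> subgroup_gen A `<=` H.
Proof. by move=> HG AH x; apply. Qed.

Lemma subgroupV H x : is_subgroup H -> H x -> H x^-1%g.
Proof. by move=> [H1 HB] /(HB _ _ H1); rewrite mul1g. Qed.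

Lemma subgroupM H x y : is_subgroup H -> H x -> H y -> H (x * y)%g.
Proof. by move=> HG Hx /(subgroupV HG) /(HG.2 _ _ Hx); rewrite invgK. Qed.

Lemma derived_subgroup n : is_subgroup (@derived G n).
Proof. by case: n => [|n] //=; exact: subgroup_genP. Qed.

Lemma derived_comm n (x y : G) : derived n x -> derived n y ->
  derived n.+1 [~ x, y]%g.
Proof. by move=> nx ny; apply: sub_subgroup_gen; exists (x, y). Qed.

Lemma derivedS_sub n : @derived G n.+1 `<=` @derived G n.
Proof.
apply: subgroup_gen_sub; first exact: derived_subgroup.
move=> _ [[x y] /= [nx ny] <-]; have nG := derived_subgroup n.
by rewrite /commg /conjg; do !(apply: subgroupM => // || apply: subgroupV => //).
Qed.

Lemma derived_conj n (g x : G) : derived n x -> derived n (x ^ g)%g.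
Proof.
elim: n x => [//|n IHn] x nx.
suff : derived n.+1 `<=` [set x : G | derived n.+1 (x ^ g)%g] by apply.
have nG := derived_subgroup n.+1.
apply: subgroup_gen_sub.
  split=> [|y z /= ny nz]; first by rewrite /= conj1g; case: nG.
  by rewrite conjMg conjVg; case: nG => _; apply.
move=> _ [[y z] /= [ny nz] <-]; rewrite /= conjRg.
by apply: derived_comm; exact: IHn.
Qed.

End SubgroupGen.

Section MarkedGroups.
Variables (k : nat) (G : marked_group k).

Lemma marked_word (g : G) : exists w, word_eval (@mg_gen _ G) w = g.
Proof.
have : subgroup_gen (range (@mg_gen _ G)) `<=`
    range (word_eval (@mg_gen _ G)).
  apply: subgroup_gen_sub.
    split; first by exists [::] => //; rewrite word_eval_nil.
    move=> _ _ [u _ <-] [v _ <-]; exists (u ++ inv_word v) => //.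
    by rewrite word_eval_cat word_eval_inv.
  move=> _ [i _ <-]; exists [:: (i, false)] => //.
  by rewrite word_eval_cons word_eval_nil mulg1.
by rewrite mg_genP => /(_ g I) [w _ <-]; exists w.
Qed.

Variable N : set G.
Hypothesis N_subgroup : is_subgroup N.
Hypothesis N_conj : forall g x, N x -> N (x ^ g)%g.

(** The quotient by [N] is presented by all the relations that hold in it, so that its group
    structure is that of [presented]. *)
Definition quotient_rel (u v : word k) : Prop :=
  N ((word_eval (@mg_gen _ G) u)^-1 * word_eval (@mg_gen _ G) v)%g.

Definition quotient_group : groupType := presented quotient_rel.

(** Normality of [N] makes [quotient_rel] a congruence already, so its closure identifies nothing
    more. *)
Lemma quotient_eqP u v : pres_eq quotient_rel u v <-> quotient_rel u v.
Proof.
split; last exact: pres_rel.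
rewrite /quotient_rel; have [N1 _] := N_subgroup.
elim=> {u v} [w|v w _ vw|u v w _ uv _ vw|u u' v v' _ uu _ vv|c|//].
- by rewrite mulVg.
- by have := subgroupV N_subgroup vw; rewrite invgM invgK.
- by have := subgroupM N_subgroup uv vw; rewrite -mulgA mulVKg.
- rewrite !word_eval_cat.
  have := subgroupM N_subgroup (N_conj (word_eval (@mg_gen _ G) v) uu) vv.
  by rewrite conjgE invgM -!mulgA mulVKg.
- have -> : word_eval (@mg_gen _ G) [:: c; inv_letter c] = 1%g.
    by rewrite !word_eval_cons; case: c => i [] /=; rewrite word_eval_nil mulg1
      ?mulgV ?mulVg.
  by rewrite word_eval_nil mulVg.
Qed.

Definition word_of (g : G) : word k := projT1 (cid (marked_word g)).

Lemma word_ofK g : word_eval (@mg_gen _ G) (word_of g) = g.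
Proof. exact: projT2 (cid (marked_word g)). Qed.

Definition quotient_map (g : G) : quotient_group :=
  presented_pi quotient_rel (word_of g).

Lemma quotient_map_eq g h : quotient_map g = quotient_map h <-> N (g^-1 * h)%g.
Proof.
rewrite /quotient_map; split=> [/presented_piE/quotient_eqP|gh].
  by rewrite /quotient_rel !word_ofK.
by apply/presented_piE/quotient_eqP; rewrite /quotient_rel !word_ofK.
Qed.

Lemma quotient_mapM : {morph quotient_map : x y / (x * y)%g}.
Proof.
move=> x y; rewrite /quotient_map.
rewrite -[RHS]/(presented_mul _ _) presented_piM.
apply/presented_piE/quotient_eqP.
rewrite /quotient_rel word_eval_cat !word_ofK mulVg.
by case: N_subgroup.
Qed.


Lemma quotient_map_surj y : exists x, quotient_map x = y.
Proof.
exists (word_eval (@mg_gen _ G) (repr y)); rewrite -[RHS]presented_reprK.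
apply/presented_piE/quotient_eqP; rewrite /quotient_rel word_ofK mulVg.
by case: N_subgroup.
Qed.

Lemma quotient_map1 g : quotient_map g = 1%g <-> N g.
Proof.
have -> : 1%g = quotient_map 1%g.
  apply/presented_piE/quotient_eqP; rewrite /quotient_rel word_ofK.
  by rewrite word_eval_nil invg1 mul1g; case: N_subgroup.
rewrite quotient_map_eq mulg1; split=> h; last exact: subgroupV.
by have := subgroupV N_subgroup h; rewrite invgK.
Qed.

Lemma quotient_map_derived n y :
  derived n y -> exists2 x, derived n x & quotient_map x = y.
Proof.
have mapV x : quotient_map x^-1%g = (quotient_map x)^-1%g.
  apply: (mulgI (quotient_map x)); rewrite -quotient_mapM !mulgV.
  by apply/quotient_map1; case: N_subgroup.
elim: n y => [|n IHn] y ny; first by have [x] := quotient_map_surj y; exists x.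
suff : derived n.+1 `<=` (quotient_map @` derived n.+1) by move=> /(_ y ny) [x]; exists x.
have nG := @derived_subgroup G n.+1.
apply: subgroup_gen_sub.
  split; first by exists 1%g; [case: nG|apply/quotient_map1; case: N_subgroup].
  move=> _ _ [u nu <-] [v nv <-]; exists (u * v^-1)%g; first by case: nG => _; apply.
  by rewrite quotient_mapM mapV.
move=> _ [[u v] /= [/IHn[u' nu <-] /IHn[v' nv <-]] <-].
exists [~ u', v']%g; first exact: derived_comm.
by rewrite !commgEl !conjgE !quotient_mapM !mapV.
Qed.

Lemma quotient_solvable n : @derived G n `<=` N -> solvable_group quotient_group.
Proof.
move=> nN; exists n; apply/seteqP; split=> [y /quotient_map_derived[x nx <-]|_ ->].
  by apply/quotient_map1; exact: nN.
by have [] := @derived_subgroup quotient_group n.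
Qed.

End MarkedGroups.

Lemma residually_solvable_derived k (G : marked_group k) :
  (forall g : G, (forall n, derived n g) -> g = 1%g) -> residually_solvable G.
Proof.
move=> G1 g g1; have [n ng] : exists n, ~ derived n g.
  by apply/existsNP => h; apply: g1; exact: G1.
have NG := @derived_subgroup G n; have NJ := @derived_conj G n.
pose Q := @quotient_group _ G (derived n).
pose qM := isMultiplicative.Build G Q _ (quotient_mapM NG NJ).
pose q : {multiplicative G -> Q} := HB.pack (@quotient_map _ G (derived n)) qM.
exists Q, q.
split; [exact: (@quotient_solvable _ _ _ NG NJ n)|exact: quotient_map_surj|].
by move=> /quotient_map1 => /(_ NG NJ).
Qed.

(** * Residual solvability of HNN extensions *)

Section DerivedSeries.
Variables (G : groupType) (T : hnn_splitting G).
Hypothesis E_derived2 : forall x : G, hnn_E T x -> derived 2 x -> x = 1%g.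

Lemma derived_add n k : @derived G (k + n) `<=` @derived G n.
Proof. by elim: k => [|k IHk] //; apply: subset_trans IHk; exact: derivedS_sub. Qed.

(* The flow through a set of edges invariant under N is a homomorphism on N,
   so it vanishes on [N, N]: a geodesic from v to f v crosses the N-orbit of its
   first edge a second time, in the other direction. Between the two crossings
   it joins some y to nu y with nu nontrivial in N. *)
Lemma derived_displacement n f v l : derived n.+2 f -> f <> 1%g ->
  tree_path T v l (f * v)%g -> (n < size l)%N.
Proof.
elim: n f v l => [|n IHn] f v l.
  move=> f2 f1; case: l => [|//] /= vfv; case: f1.
  have : (f ^ v = 1)%g by apply: E_derived2; [rewrite conjgE|exact: derived_conj].
  by move=> /eqP; rewrite conjg_eq1 => /eqP.
move=> nf f1 pl; have [l' gl] := geodesic_exists T v (f * v)%g.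
apply: leq_trans (gl.2 _ pl); move: gl => {l pl}; set l := l' => gl.
have : (0 < size l)%N.
  have f2 : derived 2 f by have := nf; rewrite -addn2; exact: derived_add.
  case: gl; case: (l) => // /= vfv; case: f1.
  have : (f ^ v = 1)%g by apply: E_derived2; [rewrite conjgE|exact: derived_conj].
  by move=> /eqP; rewrite conjg_eq1 => /eqP.
move: l gl => [|s l] gl // _.
pose N := @derived G n.+2; have NG : is_subgroup N := @derived_subgroup G n.+2.
pose D := [set y | exists2 nu, N nu & edge_coset T (nu * s.1)%g y].
have DB : edge_set T D.
  by move=> y e [nu Nnu h] Be; exists nu => //;
    exact: (@edge_coset_edge_set _ T (nu * s.1)%g y e h Be).
have DN nu : N nu -> [set y | D (nu * y)%g] = D.
  move=> Nnu; apply/seteqP; split=> y [mu Nmu h].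
    exists (nu^-1 * mu)%g; first exact: subgroupM NG (subgroupV NG Nnu) Nmu.
    by move: h; rewrite /edge_coset/= !invgM invgK !mulgA.
  exists (nu * mu)%g; first exact: subgroupM NG Nnu Nmu.
  by move: h; rewrite /edge_coset/= -(E_translate nu) !mulgA.
have chiM nu x : N nu -> hnn_flow T D (nu * x)%g = hnn_flow T D nu + hnn_flow T D x.
  by move=> Nnu; rewrite (flow_translate _ _ DB) DN.
have chiV nu : N nu -> hnn_flow T D nu^-1%g = - hnn_flow T D nu.
  move=> Nnu; apply/eqP; rewrite -addr_eq0 -chiM ?mulVg ?hnn_flow1//.
  exact: subgroupV NG Nnu.
have Df : hnn_flow T D f = 0.
  suff sub : derived n.+3 `<=` [set x | N x /\ hnn_flow T D x = 0] by have [] := sub _ nf.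
  apply: subgroup_gen_sub.
    split=> [|x y /= [Nx x0] [Ny y0]]; first by split; [case: NG|exact: hnn_flow1].
    split; first by case: NG => _; apply.
    by rewrite chiM// chiV// x0 y0 oppr0.
  move=> _ [[x y] /= [Nx Ny] <-]; have NV z : N z -> N z^-1%g by exact: subgroupV NG.
  split; first by rewrite commgEl conjgE; do !(apply: (subgroupM NG) => // || apply: NV).
  rewrite commgEl conjgE !chiM ?chiV//; first lia.
  - exact: NV.
  - exact: NV.
have Nf : N f by exact: derivedS_sub.
have := flow_path DB gl.1; rewrite chiM// Df add0r -[LHS]addr0.
move=> /addrI/esym; rewrite /crossings big_cons asboolT; last first.
  exists 1%g; first by case: NG.
  by rewrite mul1g; exact: edge_coset_self.
rewrite mulr1 => sum0.
(* If all the other crossings of [D] went the way of [s], the signed count would be a sign times a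
   positive number instead of 0. *)
have [t tl [Dt ts]] : exists2 t, t \in l & D t.1 /\ t.2 != s.2.
  apply: contrapT => h; have : (-1) ^+ s.2 * (1 + \sum_(t <- l) `[< D t.1 >]%:R) = 0 :> int.
    rewrite -[RHS]sum0 mulrDr mulr1 mulr_sumr; congr (_ + _).
    rewrite !big_seq; apply: eq_bigr => t tl.
    have [Dt|Dt] := pselect (D t.1); last by rewrite asboolF// !mulr0.
    have -> // : t.2 = s.2.
    by apply: contrapT => /eqP ts; apply: h; exists t.
  move=> /eqP; rewrite mulf_eq0 signr_eq0/=.
  have : 0 <= \sum_(t <- l) `[< D t.1 >]%:R :> int by exact: sumr_ge0.
  by set n1 := \sum_(t <- l) _; move: n1 => n1; lia.
move: Dt => [nu Nnu nst]; case/splitPr: tl gl => l1 l2 gl.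
have nu1 : nu <> 1%g.
  move=> nu1; apply: (@geodesic_edges _ T _ _ [::] l1 l2 s t gl).
  by move: nst; rewrite nu1 mul1g.
have := gl.1 => /= -[_ /tree_path_catP[z sz [zt _]]].
(* As [t] crosses the translate by [nu] of the edge of [s] the other way, its source is the
   translate of the target of [s]. So [l1] joins this target to its translate and is at least two
   steps shorter than the geodesic. *)
have tgt_src : hnn_E T ((step_src T t)^-1 * (nu * step_tgt T s))%g.
  apply: E_sym; case: nst => st1 st2; move: ts; rewrite /step_src /step_tgt.
  by case: t.2; case: s.2 => // _; move: st2; rewrite !invgM !mulgA.
have := IHn nu (step_tgt T s) l1 Nnu nu1.
move=> /(_ (tree_path_tgt tgt_src (tree_path_tgt zt sz))).
by rewrite /= size_cat /=; lia.
Qed.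

Lemma hnn_derived_trivial (g : G) : (forall n, derived n g) -> g = 1%g.
Proof.
move=> gn; apply: contrapT => g1; have [l pl] := tree_path_exists T 1%g (g * 1)%g.
by have := derived_displacement (gn (size l).+2) g1 pl; rewrite ltnn.
Qed.

End DerivedSeries.

(** * The Haagerup property of HNN extensions *)

Lemma bernoulli_le (R : realDomainType) (x : R) n : 0 <= x <= 1 ->
  1 - n%:R * x <= (1 - x) ^+ n.
Proof.
move=> /andP[x0 x1]; elim: n => [|n IHn]; first by rewrite mul0r subr0 expr0.
rewrite exprS; apply: le_trans (_ : (1 - x) * (1 - n%:R * x) <= _).
  have : 0 <= n%:R * x * x by rewrite !mulr_ge0.
  by rewrite -natr1; lra.
by rewrite ler_wpM2l// subr_ge0.
Qed.

Section FreeByAmenable.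
Variables (R : realType) (G : groupType) (T : hnn_splitting G) (F : set G).
Hypothesis FG : is_subgroup F.
Hypothesis FJ : forall g x, F x -> F (x ^ g)%g.
Hypothesis EF : forall x, hnn_E T x -> F x -> x = 1%g.

Local Notation a := (hnn_a T).
Local Notation E := (hnn_E T).
Local Notation flow := (hnn_flow T).

Definition coset_class (x : G) : set G := [set y | F (x^-1 * y)%g].

Lemma coset_class_eq x y : coset_class x = coset_class y <-> F (x^-1 * y)%g.
Proof.
split=> [e|xy].
  suff : coset_class y y by rewrite -e.
  by rewrite /coset_class/= mulVg; case: FG.
apply/seteqP; rewrite /coset_class; split=> z /= h.
  have := subgroupM FG (subgroupV FG xy) h.
  by rewrite invgM invgK -mulgA mulVKg.
by have := subgroupM FG xy h; rewrite -mulgA mulVKg.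
Qed.

Lemma coset_class_translate g x y :
  (coset_class (g * x)%g == coset_class (g * y)%g) = (coset_class x == coset_class y).
Proof.
by apply/eqP/eqP => /coset_class_eq h; apply/coset_class_eq;
  rewrite invgM -mulgA mulKg in h *.
Qed.

Definition translate_set (g : G) (W : set G) : set G := [set y | W (g^-1 * y)%g].

Lemma translate_setK g W : [set y | translate_set g W (g * y)%g] = W.
Proof. by apply/seteqP; rewrite /translate_set; split=> y /=; rewrite mulKg. Qed.

Lemma translate_edge_coset g e :
  translate_set g (edge_coset T e) = edge_coset T (g * e)%g.
Proof.
by apply/seteqP; rewrite /translate_set /edge_coset; split=> y /=;
  rewrite invgM mulgA.
Qed.

(** Stated with the flow rather than with a geodesic, so that equivariance involves no choice of
    path. *)
Definition separating (x y : G) (W : set G) : Prop :=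
  (exists e, W = edge_coset T e) /\ flow W x != flow W y.

Lemma separating_translate g x y W : separating x y W ->
  separating (g * x)%g (g * y)%g (translate_set g W).
Proof.
move=> [[e We] sep]; split.
  by exists (g * e)%g; rewrite We translate_edge_coset.
have WB : edge_set T (translate_set g W).
  by rewrite We translate_edge_coset; exact: edge_coset_edge_set.
by rewrite !(flow_translate _ _ WB) translate_setK (inj_eq (addrI _)).
Qed.

Lemma separating_finite x y : exists s : seq (set G),
  uniq s /\ forall W, W \in s <-> separating x y W.
Proof.
have [l pl] := tree_path_exists T x y.
exists [seq W <- undup [seq edge_coset T s.1 | s <- l] | flow W x != flow W y].
split=> [|W]; first by rewrite filter_uniq// undup_uniq.
rewrite mem_filter mem_undup; split.
  by move=> /andP[sep /mapP[s sl We]]; split=> //; exists s.1.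
move=> [[e We] sep]; rewrite sep /=.
have WB : edge_set T W by rewrite We; exact: edge_coset_edge_set.
have [s sl Ws] := flow_separated WB pl sep.
by apply/mapP; exists s => //; rewrite We in Ws *; exact: edge_coset_eq.
Qed.

Definition walls x y : seq (set G) := projT1 (cid (separating_finite x y)).

Lemma walls_uniq x y : uniq (walls x y).
Proof. exact: (projT2 (cid (separating_finite x y))).1. Qed.

Lemma wallsP x y W : W \in walls x y <-> separating x y W.
Proof. exact: (projT2 (cid (separating_finite x y))).2. Qed.

Variables (I : finType) (h : I -> G) (S : seq G) (r : R).
Hypothesis h_inj : forall i j, F ((h i)^-1 * h j)%g -> i = j.
Hypothesis I_gt0 : (0 < #|I|)%N.
Hypothesis r01 : 0 <= r < 1.

(* Seen from the coset z of F, the edges of S are the only ones that may be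
   crossed. *)
Definition admissible (z W : set G) : Prop :=
  exists2 u, u \in S & exists2 x, W x & z (x * u^-1)%g.

Definition wall_weight (z W : set G) : R := if `[< admissible z W >] then r else 0.

Lemma wall_weight01 z W : 0 <= wall_weight z W <= 1.
Proof.
have /andP[r0 /ltW r1] := r01.
by rewrite /wall_weight; case: ifP; rewrite ?r0 ?r1 ?lexx ?ler01.
Qed.

Definition wall_kernel (z : set G) (x y : G) : R :=
  \prod_(W <- walls x y) wall_weight z W.

(** On the points of [s] only the finitely many walls [Ws] matter; a wall that does not separate two
    points contributes the factor 1. *)
Lemma wall_kernel_psd z : psd_kernel (wall_kernel z).
Proof.
apply: psd_local => s.
pose Ws := undup (flatten [seq walls x y | x <- s, y <- s]).
exists (fun x y => \prod_(W <- Ws)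
    if flow W x == flow W y then 1 else wall_weight z W).
  by apply: psd_walls => W; exact: wall_weight01.
move=> x y xs ys; rewrite /wall_kernel.
rewrite [RHS](eq_bigr (fun W => if flow W x != flow W y then wall_weight z W else 1)).
  rewrite -big_mkcond/= -[RHS]big_filter; apply: perm_big; apply: uniq_perm.
  - exact: walls_uniq.
  - by rewrite filter_uniq// undup_uniq.
  move=> W; rewrite mem_filter mem_undup; apply/idP/andP.
    move=> Wxy; split; first by have /wallsP[] := Wxy.
    by apply/flattenP; exists (walls x y) => //; apply/allpairsP; exists (x, y).
  move=> [sep /flattenP[_ /allpairsP[[x' y'] [_ _ ->]] /wallsP[We _]]].
  exact/wallsP.
by move=> W _; case: eqP.
Qed.

Lemma wall_weight_translate g x W :
  wall_weight (coset_class (g * x)%g) (translate_set g W) =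
  wall_weight (coset_class x) W.
Proof.
rewrite /wall_weight; congr (if _ then _ else _); apply/asbool_equiv_eq; split.
  move=> [u uS [y Wy zy]]; exists u => //; exists (g^-1 * y)%g => //.
  by move: zy; rewrite /coset_class/= invgM !mulgA.
move=> [u uS [y Wy zy]]; exists u => //; exists (g * y)%g.
  by rewrite /translate_set/= mulKg.
by rewrite /coset_class/= invgM -!mulgA mulKg.
Qed.

Lemma wall_kernel_translate g z x y :
  wall_kernel (coset_class (g * z)%g) (g * x)%g (g * y)%g =
  wall_kernel (coset_class z) x y.
Proof.
have trK : cancel (translate_set g) (translate_set g^-1%g).
  move=> W; apply/seteqP; rewrite /translate_set.
  by split=> w /=; rewrite invgK mulKg.
have trVK : cancel (translate_set g^-1%g) (translate_set g).
  move=> W; apply/seteqP; rewrite /translate_set.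
  by split=> w /=; rewrite invgK mulVKg.
rewrite /wall_kernel (perm_big [seq translate_set g W | W <- walls x y])/=.
  by rewrite big_map; apply: eq_bigr => W _; exact: wall_weight_translate.
apply: uniq_perm; first exact: walls_uniq.
  by rewrite map_inj_uniq ?walls_uniq//; exact: can_inj trK.
move=> W; apply/idP/mapP => [/wallsP sep|[W' /wallsP sep ->]].
  exists (translate_set g^-1%g W); last by rewrite trVK.
  by apply/wallsP; have := separating_translate g^-1%g sep; rewrite !mulKg.
exact/wallsP/separating_translate.
Qed.

(* A matrix coefficient of the representation induced from F: the cosets h i F
   form a Folner set of G / F, and each of them weighs the edges of the tree in
   its own way, so that the average over i is positive definite on G. *)
Definition amenable_coef (g : G) : R := (#|I|%:R)^-1 *
  \sum_i \sum_j if coset_class (h i) == coset_class (g * h j)%g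
    then wall_kernel (coset_class (h i)) 1%g g else 0.

(** The kernel on [G * I] that is [wall_kernel] on each fibre of [(x, i) -> x h i F] and 0 across
    fibres is positive definite. Sum it over both indices, then translate by [x^-1]. *)
Lemma amenable_coef_psd : psd_kernel (fun x y => amenable_coef (x^-1 * y)%g).
Proof.
apply: psd_scale; first by rewrite invr_ge0.
pose cls (p : G * I) := coset_class (p.1 * h p.2)%g.
have := psd_fiber cls (fun z => psd_comp (fun p : G * I => p.1) (wall_kernel_psd z)).
move=> /psd_marginal; congr psd_kernel; apply/funext => x; apply/funext => y.
apply: eq_bigr => i _; apply: eq_bigr => j _; rewrite /cls/=.
rewrite -(coset_class_translate x (h i)) mulgA mulVKg.
by case: ifP => // _; rewrite -(wall_kernel_translate x (h i) 1%g) mulg1 mulVKg.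
Qed.

Lemma amenable_coef1 : amenable_coef 1%g = 1.
Proof.
have walls1 : walls 1%g 1%g = [::].
  case E1 : (walls 1%g 1%g) => [//|W s].
  have : W \in walls 1%g 1%g by rewrite E1 mem_head.
  by move=> /wallsP[_]; rewrite eqxx.
rewrite /amenable_coef (eq_bigr (fun=> 1)) => [|i _].
  by rewrite sumr_const mulVf// pnatr_eq0 -lt0n.
rewrite (bigD1 i)//= mul1g eqxx /wall_kernel walls1 big_nil big1 ?addr0// => j ji.
rewrite mul1g; case: eqP => // /coset_class_eq/h_inj ij.
by rewrite ij eqxx in ji.
Qed.

Lemma amenable_coef_ge g (e : R) : 0 <= e ->
  (forall i W, W \in walls 1%g g -> admissible (coset_class (h i)) W) ->
  (1 - e) * #|I|%:R <=
    #|[pred i | [exists j, coset_class (h i) == coset_class (g * h j)%g]]|%:R ->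
  (1 - e) * r ^+ size (walls 1%g g) <= amenable_coef g.
Proof.
move=> e0 adm card_ge; have /andP[r0 _] := r01.
have kE i : wall_kernel (coset_class (h i)) 1%g g = r ^+ size (walls 1%g g).
  rewrite /wall_kernel big_seq (eq_bigr (fun=> r)) => [|W Wg].
    by rewrite -big_seq big_const_seq count_predT iter_mulr mulr1.
  by rewrite /wall_weight asboolT//; exact: adm.
rewrite /amenable_coef ler_pdivlMl ?ltr0n// mulrA [_ * (1 - e)]mulrC.
apply: le_trans (ler_wpM2r _ card_ge) _; first by rewrite exprn_ge0.
rewrite mulr_natl -sumr_const big_mkcond/=; apply: ler_sum => i _.
have term_ge0 j : 0 <= if coset_class (h i) == coset_class (g * h j)%g
    then wall_kernel (coset_class (h i)) 1%g g else 0.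
  by rewrite kE; case: ifP => // _; rewrite exprn_ge0.
rewrite inE; case: existsP => [[j ij]|_]; last by apply: sumr_ge0 => k _.
rewrite (bigD1 j)//= (ifT _ _ ij) kE lerDl; apply: sumr_ge0 => k _.
by have := term_ge0 k; rewrite kE.
Qed.

(** The two edges have representatives [x] and [x'] that differ by an element of [F]. As the sources
    agree, this element also lies in [E], or in [a E a^-1] for backward steps, so it is trivial. *)
Lemma adm_edge_unique h0 u e e' (b : bool) :
  (exists2 x, edge_coset T e x & coset_class h0 (x * u^-1)%g) ->
  (exists2 x, edge_coset T e' x & coset_class h0 (x * u^-1)%g) ->
  E ((step_src T (e, b))^-1 * step_src T (e', b))%g -> edge_stab T (e^-1 * e')%g.
Proof.
move=> [x ex zx] [x' ex' zx'] src.
have Fxx : F (x^-1 * x')%g.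
  have := FJ u (subgroupM FG (subgroupV FG zx) zx').
  by rewrite conjgE !invgM !invgK !mulgA mulgVK mulgK mulVg mul1g.
have xe' : edge_stab T (e'^-1 * x')%g by [].
suff xx : (x^-1 * x' = 1)%g.
  have x'x : x' = x by apply: (mulgI x^-1%g); rewrite xx mulVg.
  have := edge_stabM ex (edge_stabV xe'); rewrite x'x.
  by rewrite invgM invgK -!mulgA mulVKg.
move: src; rewrite /step_src; case: b => /= src; last first.
  apply: EF => //; apply: E_trans (E_trans (E_sym _) src) _; last exact: ex'.1.
  exact: ex.1.
have : ((x^-1 * x') ^ a = 1)%g.
  apply: EF; last exact: FJ.
  have := E_trans (E_trans (E_sym _) src) (_ : E ((e' * a)^-1 * (x' * a))%g).
  move=> /(_ (x * a)%g); rewrite conjgE !invgM !mulgA; apply.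
    by have := ex.2; rewrite !mulgA.
  by have := ex'.2; rewrite !mulgA.
by move=> /eqP; rewrite conjg_eq1 => /eqP.
Qed.

Lemma finite_cover (P : G * bool -> set G) (s : seq (G * bool)) :
  (forall t x y, P t x -> P t y -> E (x^-1 * y)%g) ->
  exists s' : seq G, forall t x, t \in s -> P t x ->
    exists2 y, y \in s' & E (y^-1 * x)%g.
Proof.
move=> PE; elim: s => [|t s [s' IHs]]; first by exists [::].
have [[y ty]|nt] := pselect (exists y, P t y).
  exists (y :: s') => t' x; rewrite inE => /predU1P[->|t's] Px.
    by exists y; [rewrite mem_head|exact: PE Px].
  by have [z zs zx] := IHs _ _ t's Px; exists z => //; rewrite inE zs orbT.
exists s' => t' x; rewrite inE => /predU1P[->|]; last exact: IHs.
by move=> tx; case: nt; exists x.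
Qed.

(** At each vertex there is at most one admissible step for each label [u] in [S] and each
    direction. *)
Lemma finite_admissible_paths h0 n x0 : exists s : seq G, forall g l,
  tree_path T x0 l g -> size l = n ->
  (forall t, t \in l -> admissible (coset_class h0) (edge_coset T t.1)) ->
  exists2 y, y \in s & E (y^-1 * g)%g.
Proof.
elim: n x0 => [|n IHn] x0.
  by exists [:: x0] => g [|//] /= gx _ _; exists x0; rewrite ?mem_head.
pose P (p : G * bool) : set G := [set y | exists t, [/\ y = step_tgt T t,
  t.2 = p.2, E (x0^-1 * step_src T t)%g &
  exists2 x, edge_coset T t.1 x & coset_class h0 (x * p.1^-1)%g]].
have [|s1 s1P] := @finite_cover P [seq (u, b) | u <- S, b <- [:: true; false]].
  move=> [u b] _ _ [[e c] [-> /= -> src adm]] [[e' c'] [-> /= -> src' adm']].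
  have [st1 st2] := adm_edge_unique adm adm' (E_trans (E_sym src) src').
  by rewrite /step_tgt; case: b {src src'} => //=; rewrite invgM !mulgA in st2 *.
have /choice[s2 s2P] := IHn.
exists (flatten [seq s2 y | y <- s1]) => g [//|t l] /= [src pl] [szl] adm.
have [y ys1 yt] : exists2 y, y \in s1 & E (y^-1 * step_tgt T t)%g.
  have [u uS [x tx zx]] := adm t (mem_head _ _).
  apply: (s1P (u, t.2)); last by exists t; split=> //; exists x.
  by apply/allpairsP; exists (u, t.2); split=> //=; case: t.2.
have [|z zs2 zg] := s2P y g l (tree_path_src yt pl) szl.
  by move=> t' t'l; apply: adm; rewrite inE t'l orbT.
by exists z => //; apply/flattenP; exists (s2 y) => //; exact: map_f.
Qed.

Lemma wall_kernel_support z g l (c : R) : 0 < c -> geodesic T 1%g l g ->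
  c < wall_kernel z 1%g g ->
  (forall t, t \in l -> admissible z (edge_coset T t.1)) /\ c < r ^+ size l.
Proof.
have /andP[r0 r1] := r01; move=> c0 gl ck.
have sub : {subset [seq edge_coset T t.1 | t <- l] <= walls 1%g g}.
  move=> _ /mapP[t tl ->]; apply/wallsP; split; first by exists t.1.
  exact: (geodesic_flow gl tl).
have adm W : W \in walls 1%g g -> admissible z W.
  move=> Wg; apply: contrapT => nadm; move: ck.
  rewrite /wall_kernel (big_rem W)//= /wall_weight asboolF// mul0r.
  by move=> /(lt_trans c0); rewrite ltxx.
split=> [t tl|]; first by apply/adm/sub/map_f.
have := uniq_leq_size (geodesic_uniq gl) sub; rewrite size_map => szl.
apply: lt_le_trans ck _; rewrite /wall_kernel big_seq.
rewrite (eq_bigr (fun=> r)) => [|W Wg]; last by rewrite /wall_weight asboolT//; exact: adm.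
rewrite -big_seq big_const_seq count_predT iter_mulr mulr1.
by apply: ler_wiXn2l => //; exact: ltW.
Qed.

(** A large value bounds the length of an admissible path from 1 to [g], which leaves finitely many
    vertices [g E]; it also puts [g] in one of the cosets [h i (h j)^-1 F]. An element of [F] and
    [E] being trivial, both data determine [g]. *)
Lemma amenable_coef_finite : finite_set [set g | 2^-1 < amenable_coef g].
Proof.
(* If all [#|I|^2] terms were at most [c], the coefficient would be at most
   [#|I|^-1 * #|I|^2 * c = 1/2]. *)
have /andP[r0 r1] := r01; pose c : R := (2 * #|I|%:R)^-1.
have I0 : 0 < #|I|%:R :> R by rewrite ltr0n.
have c0 : 0 < c by rewrite invr_gt0 mulr_gt0.
have [n0 rn0] : exists n, forall k, (n <= k)%N -> r ^+ k <= c.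
  have : (GRing.exp r : R ^nat) @ \oo --> (0 : R) by apply: cvg_expr; rewrite ger0_norm.
  move=> /cvgrPdist_le /(_ c c0) [n _ rn]; exists n => k nk.
  by have := rn k nk; rewrite sub0r normrN => /(le_trans (ler_norm _)).
have sup g : 2^-1 < amenable_coef g -> exists i j,
    F ((h i)^-1 * (g * h j))%g /\ c < wall_kernel (coset_class (h i)) 1%g g.
  move=> gc; apply: contrapT => nP; move: gc; apply/negP; rewrite -leNgt.
  rewrite /amenable_coef ler_pdivrMl//.
  apply: (@le_trans _ _ (\sum_(i : I) \sum_(j : I) c)).
    apply: ler_sum => i _; apply: ler_sum => j _; case: eqP => [|_]; last exact: ltW.
    move=> /coset_class_eq Fij; rewrite leNgt; apply/negP => ck.
    by apply: nP; exists i, j.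
  by rewrite !sumr_const -mulr_natr -[c *+ _]mulr_natr /c le_eqVlt;
    apply/orP; left; apply/eqP; field; rewrite gt_eqF.
apply: (@sub_finite_set _ _ (\bigcup_(p in [set: I * I * 'I_n0])
    [set g | F ((h p.1.1)^-1 * (g * h p.1.2))%g /\ exists l, [/\ tree_path T 1%g l g,
      size l = p.2 & forall t, t \in l ->
        admissible (coset_class (h p.1.1)) (edge_coset T t.1)]])).
  move=> g /sup[i [j [Fij ck]]]; have [l gl] := geodesic_exists T 1%g g.
  have [adm cl] := wall_kernel_support c0 gl ck.
  have ln0 : (size l < n0)%N.
    by rewrite ltnNge; apply/negP => /rn0; rewrite leNgt cl.
  by exists (i, j, Ordinal ln0) => //=; split=> //; exists l; split=> //; exact: gl.1.
apply: bigcup_finite => [|[[i j] n] _ /=]; first exact: finite_finset.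
have [s sP] := finite_admissible_paths (h i) n 1%g.
pose Q y := [set g | F ((h i)^-1 * (g * h j))%g /\ E (y^-1 * g)%g].
apply: (@sub_finite_set _ _ [set` [seq xget 1%g (Q y) | y <- s]]) => [|//].
move=> g /= [Fg [l [pl szl adm]]]; have [y ys yg] := sP g l pl szl adm.
apply/mapP; exists y => //; apply/esym/xget_unique => // g' [Fg' yg'].
have := FJ (h j)^-1%g (subgroupM FG (subgroupV FG Fg) Fg').
rewrite conjgE !invgM !invgK !mulgA !mulgK mulgV mul1g => gg'.
by apply: (mulgI g^-1%g); rewrite mulVg; apply: EF => //; exact: E_trans (E_sym yg) yg'.
Qed.

End FreeByAmenable.

Lemma hnn_haagerup (R : realType) (G : groupType) (T : hnn_splitting G)
    (F : set G) (u : nat -> G) :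
  is_subgroup F -> (forall g x, F x -> F (x ^ g)%g) ->
  (forall x, hnn_E T x -> F x -> x = 1%g) ->
  (forall g, exists n, u n = g) ->
  (forall (k : seq G) (e : R), 0 < e -> exists (I : finType) (h : I -> G),
    [/\ (0 < #|I|)%N, (forall i j, F ((h i)^-1 * h j)%g -> i = j) &
      forall g, g \in k -> (1 - e) * #|I|%:R <=
        #|[pred i | [exists j, coset_class F (h i) == coset_class F (g * h j)%g]]|%:R]) ->
  haagerup R G.
Proof.
move=> FG FJ EF u_surj folner; apply: (haagerup_approximate_unit u_surj) => k e.
wlog e1 : e / e <= 1.
  move=> W e0; have [/W|/ltW e1] := leP e 1; first exact.
  have [//|//|P [Pp P1 Pk Pf]] := W 1; exists P; split=> // g /Pk; lra.
move=> e0; have e20 : 0 < e / 2 by rewrite divr_gt0.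
have [I [h [I0 h_inj hk]]] := folner k (e / 2) e20.
(* By Bernoulli's inequality [r^d >= 1 - e/2] for the number [d] of walls between 1 and any element
   of [k]. The Folner set costs another factor [1 - e/2], and [(1 - e/2)^2 >= 1 - e]. *)
pose M := (\max_(g <- k) size (walls T 1%g g)).+1.
pose r : R := 1 - e / 2 / M%:R.
have M0 : 0 < M%:R :> R by rewrite ltr0n.
have eM : 0 < e / 2 / M%:R <= 1.
  rewrite divr_gt0//= ler_pdivrMr// mul1r (le_trans (_ : _ <= 1))//; first lra.
  by rewrite ler1n.
have r01 : 0 <= r < 1 by rewrite /r; lra.
pose W_pt (W : set G) := xget 1%g W.
(* With these labels, every wall between 1 and an element of [k] is admissible from every coset
   [h i F]. *)
pose S := [seq ((h i)^-1 * W_pt W)%g |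
  i <- enum I, W <- flatten [seq walls T 1%g g | g <- k]].
exists (amenable_coef T F h S r); split.
- exact: amenable_coef_psd.
- exact: amenable_coef1.
- move=> g gk.
  have adm i W : W \in walls T 1%g g -> admissible S (coset_class F (h i)) W.
    move=> Wg; exists ((h i)^-1 * W_pt W)%g.
      apply/allpairsP; exists (i, W); split=> //=; first by rewrite mem_enum.
      by apply/flattenP; exists (walls T 1%g g) => //; exact: map_f.
    exists (W_pt W).
      have /wallsP[[x ->] _] := Wg; apply: xgetPex; exists x.
      exact: edge_coset_self.
    by rewrite /coset_class/= invgM invgK mulVKg mulVg; case: FG.
  apply: le_trans (amenable_coef_ge I0 r01 (ltW e20) adm (hk g gk)).
  have rM : 1 - e / 2 <= r ^+ size (walls T 1%g g).
    apply: le_trans (bernoulli_le _ _); last by lra.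
    rewrite lerD2l lerN2 mulrA ler_pdivrMr// mulrC ler_wpM2l ?(ltW e20)//.
    by rewrite ler_nat ltnW// ltnS; exact: leq_bigmax_seq.
  have h2 : 0 <= (1 - e / 2) * (r ^+ size (walls T 1%g g) - (1 - e / 2)).
    by apply: mulr_ge0; lra.
  have := sqr_ge0 (e / 2); lra.
- exact: amenable_coef_finite.
Qed.

(** * Baumslag-Solitar groups *)

Section CyclicSubgroup.
Variables (G : groupType) (b : G).

Definition cyclic_subgroup : set G :=
  [set x | exists k l : nat, x = (b ^+ k * (b ^+ l)^-1)%g].

Lemma cyclic_subgroupP : is_subgroup cyclic_subgroup.
Proof.
split=> [|_ _ [k [l ->]] [k' [l' ->]]]; first by exists 0, 0; rewrite !expg0 mulgV.
exists (k + l')%N, (l + k')%N; rewrite !expgnDr !invgM invgK !mulgA.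
have bC i j : commute (b ^+ i)%g (b ^+ j)%g by apply: commuteX2.
rewrite -[((b ^+ k) * _ * (b ^+ l'))%g]mulgA.
rewrite (commute_sym (commuteV (bC l' l))) !mulgA -!mulgA; congr (_ * (_ * _))%g.
by rewrite -!invgM; congr (_^-1)%g; exact: bC.
Qed.

Lemma mem_cyclic_subgroup : cyclic_subgroup b.
Proof. by exists 1, 0; rewrite expg0 invg1 mulg1. Qed.

End CyclicSubgroup.

Section TwoGenerators.
Variables (G : groupType) (s : 'I_2 -> G).

Definition letter_val (c : 'I_2 * bool) : G := if c.2 then (s c.1)^-1%g else s c.1.

(** On the tree path of a word, the letter [a] at [x] crosses the edge [x] forwards, [a^-1] crosses
    the edge [x a^-1] backwards, and [b] stays at its vertex. *)
Definition letter_crossing (D : set G) (x : G) (c : 'I_2 * bool) : int :=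
  if c.1 == a_ then
    if c.2 then - `[< D (x * (s a_)^-1)%g >]%:R else `[< D x >]%:R
  else 0.

Fixpoint word_crossing (D : set G) (x : G) (w : word 2) : int :=
  if w is c :: w' then letter_crossing D x c + word_crossing D (x * letter_val c)%g w'
  else 0.

Lemma word_crossing_cat D x u v : word_crossing D x (u ++ v) =
  word_crossing D x u + word_crossing D (x * word_eval s u)%g v.
Proof.
elim: u x => [|c u IHu] x /=; first by rewrite word_eval_nil mulg1 add0r.
by rewrite IHu addrA word_eval_cons mulgA.
Qed.

Lemma word_crossing_b D x n e : word_crossing D x (nseq n (b_, e)) = 0.
Proof. by elim: n x => [|n IHn] x //=; rewrite IHn. Qed.

Lemma word_eval_nseq n c : word_eval s (nseq n c) = (letter_val c ^+ n)%g.
Proof.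
elim: n => [|n IHn]; first by rewrite word_eval_nil expg0.
by rewrite /= word_eval_cons IHn expgS.
Qed.

End TwoGenerators.

Lemma ord2_case (i : 'I_2) : i = a_ \/ i = b_.
Proof. by case: i => [[|[|//]] i2]; [left|right]; apply: val_inj. Qed.

(* The affine map x -> p.1 x + p.2 attached to a word when a acts as
   multiplication by y and b as translation by 1. *)
Fixpoint word_affine (K : fieldType) (y : K) (w : word 2) : K * K :=
  if w is c :: w' then
    let p := word_affine y w' in
    if c.1 == a_ then
      let z := if c.2 then y^-1 else y in (z * p.1, z * p.2)
    else (p.1, (if c.2 then -1 else 1) + p.2)
  else (1, 0).

Section WordAffine.
Variables (K : fieldType) (y : K).
Hypothesis y0 : y != 0.
Local Notation A := (word_affine y).

Lemma word_affine_cat u v :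
  A (u ++ v) = ((A u).1 * (A v).1, (A u).2 + (A u).1 * (A v).2).
Proof.
elim: u => [|c u /= ->]; first by rewrite /= !mul1r add0r; case: (A v).
by case: ifP => _ /=; rewrite ?mulrDr ?mulrA ?addrA.
Qed.

Lemma word_affine_b n e :
  A (nseq n (b_, e)) = (1, if e then - n%:R else n%:R).
Proof.
elim: n => [|n /= ->] /=; first by case: e; rewrite ?oppr0.
by case: e; rewrite -natr1 addrC ?opprD.
Qed.

Lemma word_affine_a n e : A (nseq n (a_, e)) = ((if e then y^-1 else y) ^+ n, 0).
Proof. by elim: n => [|n /= ->] /=; rewrite ?mulr0 ?exprS. Qed.

Lemma word_affine_neq0 w : (A w).1 != 0.
Proof.
elim: w => [|c w IHw] /=; first exact: oner_neq0.
by case: ifP => //= _; rewrite mulf_neq0//; case: c.2; rewrite ?invr_neq0.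
Qed.

Lemma word_affine_pres (m n : int) u v :
  n%:~R = y * m%:~R -> pres_eq (BS_rel m n) u v -> A u = A v.
Proof.
move=> ny; elim=> {u v} [//|v w _ ->//|u v w _ -> _ ->//|u u' v v' _ uu _ vv|c|].
- by rewrite !word_affine_cat uu vv.
- rewrite /= /inv_letter; case: c => i [] /=; case: (i == a_) => /=.
  + by rewrite !mulr0 mulr1 mulVf.
  + by rewrite addr0 addNr.
  + by rewrite !mulr0 mulr1 mulfV.
  + by rewrite addr0 subrr.
- move=> _ _ []; rewrite /b_pow /= word_affine_cat !word_affine_b /= !mulr0 addr0.
  have sgn (k : int) : (if k < 0 then - (`|k|%N%:R : K) else `|k|%N%:R) = k%:~R.
    case: ltP => k0; rewrite pmulrn; first by rewrite ltz0_abs// mulrNz opprK.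
    by rewrite gez0_abs.
  by rewrite !sgn mul1r mulr1 mulfV// ny.
Qed.

End WordAffine.

Section BaumslagSolitarGroup.
Variables (m n : int).
Hypotheses (m_neq0 : m != 0) (n_neq0 : n != 0).

Let BSmn : groupType := BS m n.
Let s : 'I_2 -> BSmn := @mg_gen _ (BS m n).

Lemma BS_eval_eq u v : word_eval s u = word_eval s v <-> pres_eq (BS_rel m n) u v.
Proof. by rewrite !presented_eval; exact: presented_piE. Qed.

Lemma BS_affine u v : word_eval s u = word_eval s v ->
  word_affine (n%:~R / m%:~R : rat) u = word_affine (n%:~R / m%:~R) v.
Proof.
move=> /BS_eval_eq; apply: word_affine_pres.
  by rewrite mulf_neq0 ?invr_eq0 ?intr_eq0.
by rewrite divfK ?intr_eq0.
Qed.

Definition BS_edge_stab (x : BSmn) : Prop := cyclic_subgroup (s b_) x /\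
  cyclic_subgroup (s b_) ((s a_)^-1 * x * s a_)%g.

Lemma b_pow_cyclic k : cyclic_subgroup (s b_) (word_eval s (b_pow k)).
Proof.
rewrite /b_pow word_eval_nseq /letter_val/=; case: (k < 0) => /=.
  exists 0, `|k|%N; rewrite expg0 mul1g.
  by elim: `|k|%N => [|j IHj]; rewrite ?expg0 ?invg1// expgS IHj expgSr invgM.
by exists `|k|%N, 0; rewrite expg0 invg1 mulg1.
Qed.

(** The word [a b^m a^-1] read from [x] crosses the edge [x] forwards and the edge [x b^n]
    backwards. These are the same edge, since [b^n] and [a^-1 b^n a = b^m] are powers of [b]. *)
Lemma BS_crossing (D : set BSmn) u v :
  (forall x e, D x -> BS_edge_stab e -> D (x * e)%g) ->
  word_eval s u = word_eval s v ->
  forall x, word_crossing s D x u = word_crossing s D x v.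
Proof.
move=> DB /BS_eval_eq.
elim=> {u v} [//|v w _ IH x|u v w _ IHu _ IHv x|u u' v v' uu IHu vv IHv x|c x|].
- by rewrite IH.
- by rewrite IHu.
- rewrite !word_crossing_cat IHu IHv; congr (_ + word_crossing _ _ (_ * _)%g _).
  exact/BS_eval_eq.
- rewrite /= /letter_crossing /letter_val /inv_letter/= addr0.
  case: c => i [] /=; case: eqP => [->|_]; rewrite ?addr0//.
    by rewrite addNr.
  by rewrite mulgK subrr.
move=> _ _ [] x; pose r : word 2 := (a_, false) :: b_pow m ++ [:: (a_, true)].
rewrite -/r.
have Br : BS_edge_stab (word_eval s (b_pow n)).
  split; first exact: b_pow_cyclic.
  have <- : word_eval s r = word_eval s (b_pow n).
    by apply/BS_eval_eq/pres_rel.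
  rewrite /r word_eval_cons word_eval_cat word_eval_cons word_eval_nil /= mulg1.
  by rewrite !mulgA mulVg mul1g mulgVK; exact: b_pow_cyclic.
have rE : word_eval s r = word_eval s (b_pow n) by apply/BS_eval_eq/pres_rel.
rewrite word_crossing_b /r -cat1s !word_crossing_cat word_crossing_b /=.
rewrite !addr0 add0r /letter_crossing/=.
have -> : (x * word_eval s [:: (a_, false)] * word_eval s (b_pow m) * (s a_)^-1)%g =
    (x * word_eval s (b_pow n))%g.
  have -> : word_eval s [:: (a_, false)] = s a_.
    by rewrite word_eval_cons word_eval_nil mulg1.
  rewrite -rE /r word_eval_cons word_eval_cat word_eval_cons word_eval_nil /=.
  by rewrite mulg1 !mulgA.
suff -> : `[< D (x * word_eval s (b_pow n))%g >] = `[< D x >] by rewrite subrr.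
apply/asbool_equiv_eq; split=> [h|h]; last exact: DB.
have [B1 B2] := Br; rewrite -[x](mulgK (word_eval s (b_pow n))); apply: DB => //.
have cG := cyclic_subgroupP (s b_).
split; first exact: subgroupV cG B1.
by have := subgroupV cG B2; rewrite !invgM invgK mulgA.
Qed.

End BaumslagSolitarGroup.

(** * Ultralimits of Baumslag-Solitar groups *)

Section WordCrossingTransfer.
Variables (G1 G2 : groupType) (s1 : 'I_2 -> G1) (s2 : 'I_2 -> G2).
Variables (D1 : set G1) (D2 : set G2).

Lemma eq_word_crossing q w :
  (forall i, (i <= size w)%N -> D1 (word_eval s1 (q ++ take i w)) <->
    D2 (word_eval s2 (q ++ take i w))) ->
  word_crossing s1 D1 (word_eval s1 q) w = word_crossing s2 D2 (word_eval s2 q) w.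
Proof.
elim: w q => [//|c w IHw] q agree /=.
have snoc (G : groupType) (s : 'I_2 -> G) :
    (word_eval s q * letter_val s c)%g = word_eval s (q ++ [:: c]).
  by rewrite word_eval_cat word_eval_cons word_eval_nil mulg1.
rewrite !snoc; congr (_ + _); last first.
  by apply: IHw => i iw; have := agree i.+1 iw; rewrite /= -cat1s catA.
rewrite /letter_crossing; case: eqP => // c1.
have := agree 0 isT; rewrite take0 cats0 => h0.
have := agree 1 isT; rewrite /= take0 -!snoc /letter_val c1.
case: c.2 => h1; first by congr (- _%:R); congr nat_of_bool; apply/asbool_equiv_eq.
by congr (_%:R); congr nat_of_bool; apply/asbool_equiv_eq.
Qed.

End WordCrossingTransfer.

Section Ultralimit.
Variables (m : int) (xi_ : nat -> int) (G : marked_group 2) (U : set_system nat).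
Hypotheses (m_neq0 : m != 0) (xi_neq0 : forall n, xi_ n != 0).
Hypothesis (UU : UltraFilter U).
Hypothesis G_lim : forall w : word 2,
  U [set n | word_eval (@mg_gen _ (BS m (xi_ n))) w = 1%g <->
             word_eval (@mg_gen _ G) w = 1%g].

Local Notation evn n w := (word_eval (@mg_gen _ (BS m (xi_ n))) w).
Local Notation evG w := (word_eval (@mg_gen _ G) w).
Local Notation bn n := (@mg_gen _ (BS m (xi_ n)) b_).

Let UF : ProperFilter U. Proof. exact: ultra_proper. Qed.

Lemma ultra_decides (P : nat -> Prop) : U [set n | P n <-> U P].
Proof.
have [UP|UP] := in_ultra_setVsetC P UU; first by apply: filterS (UP) => n Pn; split.
have nP : ~ U P by move=> P'; have [n []] := filter_ex (filterI UP P').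
by apply: filterS UP => n Pn; split.
Qed.

Lemma ultra_forall_in (T : eqType) (s : seq T) (P : T -> nat -> Prop) :
  (forall t, U (P t)) -> U [set n | forall t, t \in s -> P t n].
Proof.
move=> UP; elim: s => [|t s IHs]; first by apply: filterS filterT.
apply: filterS (filterI (UP t) IHs) => n [Pt Ps] t'.
by rewrite inE => /predU1P[->|/Ps].
Qed.

Lemma lim_eq u v : evG u = evG v <-> U [set n | evn n u = evn n v].
Proof.
have eq1 (H : groupType) (s : 'I_2 -> H) :
    word_eval s u = word_eval s v <-> word_eval s (inv_word u ++ v) = 1%g.
  rewrite word_eval_cat word_eval_inv; split=> [->|e]; first exact: mulVg.
  by apply: (mulgI (word_eval s u)^-1%g); rewrite e mulVg.
split=> [/eq1 uv|uv].
  by apply: filterS (G_lim (inv_word u ++ v)) => n /= h; apply/eq1/h.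
have [n /= [/eq1 uvn h]] := filter_ex (filterI uv (G_lim (inv_word u ++ v))).
by apply/eq1/h.
Qed.

Definition lim_E (x : G) : Prop :=
  U [set n | cyclic_subgroup (bn n) (evn n (word_of x))].

Lemma lim_EP w : lim_E (evG w) <-> U [set n | cyclic_subgroup (bn n) (evn n w)].
Proof.
have /lim_eq e : evG (word_of (evG w)) = evG w by exact: word_ofK.
by split=> h; apply: filterS (filterI e h) => n [/= ->].
Qed.

Lemma lim_E1 : lim_E 1%g.
Proof.
rewrite -[1%g](word_eval_nil (@mg_gen _ G)); apply/lim_EP.
apply: filterS filterT => n _ /=; rewrite word_eval_nil.
by have [] := cyclic_subgroupP (bn n).
Qed.

Lemma lim_EV x : lim_E x -> lim_E x^-1%g.
Proof.
move=> Ex; rewrite -[x]word_ofK -word_eval_inv; apply/lim_EP.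
apply: filterS Ex => n /= Ex; rewrite word_eval_inv.
exact: subgroupV (cyclic_subgroupP _) Ex.
Qed.

Lemma lim_EM x y : lim_E x -> lim_E y -> lim_E (x * y)%g.
Proof.
move=> Ex Ey; rewrite -[x]word_ofK -[y]word_ofK -word_eval_cat; apply/lim_EP.
apply: filterS (filterI Ex Ey) => n /= [{}Ex {}Ey]; rewrite word_eval_cat.
exact: subgroupM (cyclic_subgroupP _) Ex Ey.
Qed.

Local Notation ga := (@mg_gen _ G a_).
Local Notation gb := (@mg_gen _ G b_).

Definition lim_edge_stab (x : G) : Prop := lim_E x /\ lim_E (ga^-1 * x * ga)%g.

Lemma lim_edge_stabP w : lim_edge_stab (evG w) <->
  U [set n | BS_edge_stab (m := m) (n := xi_ n) (evn n w)].
Proof.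
have conjE (H : groupType) (s : 'I_2 -> H) : ((s a_)^-1 * word_eval s w * s a_)%g =
    word_eval s ([:: (a_, true)] ++ w ++ [:: (a_, false)]).
  by rewrite !word_eval_cat !word_eval_cons word_eval_nil /= !mulg1 mulgA.
rewrite /lim_edge_stab conjE !lim_EP; split=> [[h1 h2]|h].
  by apply: filterS (filterI h1 h2) => n /=; rewrite -conjE.
by split; apply: filterS h => n /= []; rewrite conjE.
Qed.

(* The set D need not be a limit of subsets of the BS(m, xi_n), but only its
   values on the finitely many prefixes of the two words matter. *)
Lemma lim_crossing (D : set G) u v :
  (forall x e, D x -> lim_edge_stab e -> D (x * e)%g) ->
  lim_E ((evG u)^-1 * evG v)%g ->
  word_crossing (@mg_gen _ G) D 1%g u = word_crossing (@mg_gen _ G) D 1%g v.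
Proof.
move=> DB; rewrite -word_eval_inv -word_eval_cat => /lim_EP uv.
pose prefs (w : word 2) := [seq take i w | i <- iota 0 (size w).+1].
pose ps := prefs u ++ prefs v.
have /ultra_forall_in := fun pq : word 2 * word 2 =>
  ultra_decides (fun n => BS_edge_stab (m := m) (n := xi_ n)
    (evn n (inv_word pq.1 ++ pq.2))).
move=> /(_ [seq (p, q) | p <- ps, q <- ps]) dec.
have [n /= [decn [k [l uvn]]]] := filter_ex (filterI dec uv).
(* The edges of [BS m (xi_ n)] named by the prefixes that lie in [D]. By the choice of [n], two
   prefixes name the same edge there exactly when they do so for most indices, so [Dn] contains the
   same prefixes as [D]. *)
pose Dn := [set y | exists2 p, p \in ps & D (evG p) /\
  BS_edge_stab (m := m) (n := xi_ n) ((evn n p)^-1 * y)%g].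
have cG := cyclic_subgroupP (bn n).
have stabM x y : BS_edge_stab (m := m) (n := xi_ n) x ->
    BS_edge_stab (m := m) (n := xi_ n) y -> BS_edge_stab (x * y)%g.
  move=> [x1 x2] [y1 y2]; split; first exact: subgroupM cG x1 y1.
  by have := subgroupM cG x2 y2; rewrite !mulgA mulgK.
have DnB x e : Dn x -> BS_edge_stab e -> Dn (x * e)%g.
  by move=> [p ps_p [Dp px]] Be; exists p; rewrite // mulgA; split=> //; exact: stabM.
have agree p : p \in ps -> D (evG p) <-> Dn (evn n p).
  move=> ps_p; split=> [Dp|[q ps_q [Dq qp]]].
    exists p => //; split=> //; rewrite mulVg.
    by split; rewrite ?mulg1 ?mulVg; case: cG.
  have qp_in : (q, p) \in [seq (p, q) | p <- ps, q <- ps].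
    by apply/allpairsP; exists (q, p).
  have /= := decn (q, p) qp_in; rewrite word_eval_cat word_eval_inv => -[h _].
  have {}h := h qp; move/lim_edge_stabP : h.
  by rewrite word_eval_cat word_eval_inv => /(DB _ _ Dq); rewrite mulVKg.
have transfer w : {subset prefs w <= ps} ->
    word_crossing (@mg_gen _ G) D 1%g w =
    word_crossing (@mg_gen _ (BS m (xi_ n))) Dn 1%g w.
  move=> wps; have := @eq_word_crossing _ _ (@mg_gen _ G) (@mg_gen _ (BS m (xi_ n)))
    D Dn [::] w; rewrite !word_eval_nil; apply => i iw; apply: agree; apply: wps.
  by apply/mapP; exists i => //; rewrite mem_iota.
rewrite !transfer; try by move=> p; rewrite mem_cat => ->; rewrite ?orbT.
rewrite (@BS_crossing m (xi_ n) Dn v (u ++ nseq k (b_, false) ++ nseq l (b_, true)))//.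
  by rewrite !word_crossing_cat !word_crossing_b !addr0.
rewrite !word_eval_cat !word_eval_nseq /letter_val/=.
have -> : ((bn n)^-1 ^+ l)%g = ((bn n) ^+ l)^-1%g.
  by elim: (l) => [|j IHj]; rewrite ?expg0 ?invg1// expgS IHj expgSr invgM.
by rewrite -uvn word_eval_cat word_eval_inv mulVKg.
Qed.

(** The word chosen for 1 may be nonempty; subtracting its crossings makes the flow vanish at 1 for
    every [D], a union of edges or not. *)
Definition lim_flow (D : set G) (x : G) : int :=
  word_crossing (@mg_gen _ G) D 1%g (@word_of _ G x) -
  word_crossing (@mg_gen _ G) D 1%g (@word_of _ G 1%g).

Lemma lim_gen (P : set G) : P 1%g ->
  (forall x e, P x -> lim_E e -> P (x * e)%g) ->
  (forall x, P x -> P (x * ga)%g) ->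
  (forall x, P x -> P (x * ga^-1)%g) -> forall x, P x.
Proof.
move=> P1 PE Pa PV x; rewrite -[x]word_ofK.
have Eb : lim_E gb.
  have -> : gb = evG [:: (b_, false)].
    by rewrite word_eval_cons word_eval_nil mulg1.
  apply/lim_EP; apply: filterS filterT => n _ /=.
  rewrite word_eval_cons word_eval_nil mulg1; exact: mem_cyclic_subgroup.
elim/last_ind: (word_of x) => [|w c Pw]; first by rewrite word_eval_nil.
rewrite -cats1 word_eval_cat word_eval_cons word_eval_nil mulg1.
case: c => i e /=; have [->|->] := ord2_case i; case: e; first exact: PV.
- exact: Pa.
- by apply: PE => //; exact: lim_EV.
- exact: PE.
Qed.

Lemma lim_flow1 D : lim_flow D 1%g = 0.
Proof. by rewrite /lim_flow subrr. Qed.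

Lemma lim_flow_a (D : set G) :
  (forall x e, D x -> lim_E e -> lim_E (ga^-1 * e * ga)%g -> D (x * e)%g) ->
  forall x, lim_flow D (x * ga)%g = lim_flow D x + `[< D x >]%:R.
Proof.
move=> DB x; have DB' y e : D y -> lim_edge_stab e -> D (y * e)%g.
  by move=> Dy [e1 e2]; exact: DB.
have wa : evG (word_of x ++ [:: (a_, false)]) = (x * ga)%g.
  by rewrite word_eval_cat word_eval_cons word_eval_nil mulg1 word_ofK.
rewrite /lim_flow (@lim_crossing D _ (word_of x ++ [:: (a_, false)]))//; last first.
  by rewrite wa word_ofK mulVg; exact: lim_E1.
by rewrite word_crossing_cat mul1g word_ofK /= /letter_crossing/= addr0 addrAC.
Qed.

Lemma lim_flow_E (D : set G) :
  (forall x e, D x -> lim_E e -> lim_E (ga^-1 * e * ga)%g -> D (x * e)%g) ->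
  forall x e, lim_E e -> lim_flow D (x * e)%g = lim_flow D x.
Proof.
move=> DB x e Ee; have DB' y f : D y -> lim_edge_stab f -> D (y * f)%g.
  by move=> Dy [f1 f2]; exact: DB.
rewrite /lim_flow (@lim_crossing D _ (word_of x))// !word_ofK.
by rewrite invgM mulgVK; exact: lim_EV.
Qed.

Definition lim_splitting : hnn_splitting G :=
  HNN lim_E1 lim_EV lim_EM lim_gen lim_flow1 lim_flow_a lim_flow_E.

End Ultralimit.

(** Applied at [xi_n / m], which exceeds any constant in absolute value for most [n]: a nonzero
    polynomial cannot vanish there. *)
Lemma poly_bounded_below (p : {poly rat}) : p != 0 ->
  exists C c : rat, 0 < c /\ forall y, C < `|y| -> c <= `|p.[y]|.
Proof.
elim/poly_ind: p => [|p c IHp]; first by rewrite eqxx.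
have [->|p0 _] := eqVneq p 0.
  rewrite mul0r add0r polyC_eq0 => c0; exists 0, `|c|.
  by rewrite normr_gt0 c0; split=> // y _; rewrite hornerC.
have [C [e [e0 pe]]] := IHp p0.
exists (Num.max C ((`|c| + 1) / e)), 1; split=> // y.
rewrite gt_max => /andP[/pe py]; rewrite ltr_pdivrMr// => cy.
rewrite hornerMXaddC; have := lerB_normD (p.[y] * y) c.
apply: le_trans; rewrite normrM.
have : `|y| * e <= `|y| * `|p.[y]| by rewrite ler_wpM2l.
by rewrite [`|p.[y]| * _]mulrC; lra.
Qed.

Lemma word_affine_inv (K : fieldType) (y : K) w : y != 0 ->
  word_affine y (inv_word w) = ((word_affine y w).1^-1,
    - ((word_affine y w).1^-1 * (word_affine y w).2)).
Proof.
move=> y0; elim: w => [|c w IHw]; first by rewrite /= invr1 mulr0 oppr0.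
rewrite /inv_word map_cons rev_cons -cats1 -/(inv_word w) word_affine_cat// IHw.
have p0 := word_affine_neq0 y0 w.
rewrite /= /inv_letter; case: c => i e /=; case: (i == a_); case: e => /=;
  by congr (_, _); field; rewrite ?p0 ?y0.
Qed.

(** * Folner sets *)

Section FolnerCounting.
Variables (G : groupType) (F : set G) (I : finType) (h : I -> G).
Hypothesis FG : is_subgroup F.
Hypothesis FJ : forall g x, F x -> F (x ^ g)%g.
Hypothesis h_inj : forall i j, F ((h i)^-1 * h j)%g -> i = j.

Local Notation cls := (coset_class F).

Definition escaping (g : G) : {pred I} :=
  [pred j | ~~ [exists i, cls (h i) == cls (g * h j)%g]].

Lemma escaping1 : #|escaping 1%g| = 0.
Proof.
apply: eq_card0 => j; rewrite !inE; apply/negbTE/negPn/existsP; exists j.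
by rewrite mul1g.
Qed.

(** An index [j] that escapes under [g g'] but not under [g'] is sent by [g'] to an index [f j] that
    escapes under [g]; [f] is injective because the cosets [h i F] are distinct. *)
Lemma escapingM g g' :
  (#|escaping (g * g')%g| <= #|escaping g'| + #|escaping g|)%N.
Proof.
rewrite -(cardID (escaping g')) leq_add//.
  by apply/subset_leq_card/fintype.subsetP => j; rewrite !inE => /andP[].
pose f j := odflt j [pick i | cls (h i) == cls (g' * h j)%g].
have fP j : j \in [predD escaping (g * g')%g & escaping g'] ->
    cls (h (f j)) = cls (g' * h j)%g /\ f j \in escaping g.
  rewrite !inE negbK => /andP[/existsP[i ij]] nj; rewrite /f.
  case: pickP => [i' /eqP i'j|/(_ i)]; last by rewrite ij.
  split=> //=; apply: contra nj => /existsP[k ki]; apply/existsP; exists k.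
  by rewrite (eqP ki) -mulgA (coset_class_translate FG) i'j.
have f_inj : {in [predD escaping (g * g')%g & escaping g'] &, injective f}.
  move=> j j' jP j'P e; apply: h_inj; apply/(coset_class_eq FG).
  have [e1 _] := fP j jP; have [e2 _] := fP j' j'P.
  apply/eqP; rewrite -(coset_class_translate FG g'); apply/eqP.
  by rewrite -e1 -e2 e.
rewrite -(card_in_image f_inj).
apply/subset_leq_card/fintype.subsetP => y /(@fintype.imageP _ _ f)[j jP ->].
exact: (fP j jP).2.
Qed.

(** Translating by [g^-1] turns the cosets that are hit into those that do not escape. *)
Lemma good_card g : #|[pred i | [exists j, cls (h i) == cls (g * h j)%g]]| =
  (#|I| - #|escaping g^-1%g|)%N.
Proof.
rewrite -(cardC (escaping g^-1%g)) addKn; apply: eq_card => i.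
rewrite !inE negbK; apply: eq_existsb => j.
by rewrite -(coset_class_translate FG g^-1%g) mulKg eq_sym.
Qed.

End FolnerCounting.

Lemma card_fibers (N : nat) (I : finType) (P : {pred I}) (f : 'I_N -> I -> I) :
  (forall k k' x x', x \in P -> x' \in P -> f k x = f k' x' -> k = k' /\ x = x') ->
  (N * #|P| <= #|I|)%N.
Proof.
move=> f_inj; rewrite -[N in (N * _)%N]card_ord -cardX.
have inj : {in [predX 'I_N & P] &, injective (fun p : 'I_N * I => f p.1 p.2)}.
  move=> [k x] [k' x'] /andP[_ xP] /andP[_ x'P] e.
  by have [/= -> ->] := f_inj _ _ _ _ xP x'P e.
by rewrite -(card_in_image inj); exact: max_card.
Qed.

(** * The affine quotient of the limit group *)

Section UltralimitAffine.
Variables (m : int) (xi_ : nat -> int) (G : marked_group 2) (U : set_system nat).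
Hypotheses (m_neq0 : m != 0) (xi_neq0 : forall n, xi_ n != 0).
Hypothesis (UU : UltraFilter U).
Hypothesis G_lim : forall w : word 2,
  U [set n | word_eval (@mg_gen _ (BS m (xi_ n))) w = 1%g <->
             word_eval (@mg_gen _ G) w = 1%g].
Hypothesis xi_large : forall k, U [set n | (k < `|xi_ n|)%N].

Local Notation evn n w := (word_eval (@mg_gen _ (BS m (xi_ n))) w).
Local Notation evG w := (word_eval (@mg_gen _ G) w).

Let UF : ProperFilter U. Proof. exact: ultra_proper. Qed.

Definition lim_ratio n : rat := (xi_ n)%:~R / m%:~R.
Local Notation A n := (word_affine (lim_ratio n)).

Lemma lim_ratio_neq0 n : lim_ratio n != 0.
Proof. by rewrite mulf_neq0 ?invr_eq0 ?intr_eq0. Qed.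

Lemma lim_ratio_large (C : rat) : U [set n | C < `|lim_ratio n|].
Proof.
have m0 : 0 < `|m%:~R| :> rat by rewrite normr_gt0 intr_eq0.
apply: filterS (xi_large (Num.truncn (`|C| * `|m%:~R|)).+1) => n /= xn.
rewrite /lim_ratio normrM normfV ltr_pdivlMr//.
have C0 : 0 <= `|C| * `|m%:~R| :> rat by rewrite mulr_ge0.
have /andP[_ lt1] := truncn_itv C0.
apply: le_lt_trans (_ : `|C| * `|m%:~R| < _); first by rewrite ler_wpM2r// ler_norm.
have <- : `|xi_ n|%N%:R = `|(xi_ n)%:~R| :> rat by rewrite -intr_norm pmulrn abszE.
by apply: lt_le_trans lt1 _; rewrite ler_nat ltnW.
Qed.

(* The kernel of the ultraproduct of the affine representations of the
   BS(m, xi_n). *)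
Definition lim_kernel (x : G) : Prop := U [set n | A n (word_of x) = (1, 0)].

Lemma lim_affine_eq u v : evG u = evG v -> U [set n | A n u = A n v].
Proof.
move=> /(lim_eq UU G_lim); apply: filterS => n /=.
exact: (BS_affine m_neq0 (xi_neq0 n)).
Qed.

Lemma lim_kernelP w : lim_kernel (evG w) <-> U [set n | A n w = (1, 0)].
Proof.
have e : evG (word_of (evG w)) = evG w by exact: word_ofK.
by split=> h; apply: filterS (filterI (lim_affine_eq e) h) => n [/= ->].
Qed.

Lemma lim_kernel_eqP u v :
  lim_kernel ((evG u)^-1 * evG v)%g <-> U [set n | A n u = A n v].
Proof.
rewrite -word_eval_inv -word_eval_cat lim_kernelP.
have invE n : (A n (inv_word u ++ v) = (1, 0)) <-> A n u = A n v.
  have p0 := word_affine_neq0 (lim_ratio_neq0 n) u.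
  rewrite word_affine_cat.
  rewrite (word_affine_inv _ (lim_ratio_neq0 n)).
  case: (A n u) (A n v) p0 => [p1 p2] [q1 q2] /= p0.
  split=> [[e1 e2]|[<- <-]]; last by rewrite mulVf// addNr.
  have q1E : q1 = p1 by rewrite -[LHS](mulVKf p0) e1 mulr1.
  congr (_, _); first by [].
  by rewrite -[LHS](mulVKf p0) -[RHS](mulVKf p0); congr (_ * _); lra.
by split; apply: filterS => n /= /invE.
Qed.

Lemma lim_kernel_subgroup : is_subgroup lim_kernel.
Proof.
split=> [|x y].
  rewrite -(word_eval_nil (@mg_gen _ G)); apply/lim_kernelP.
  exact: filterS filterT.
rewrite -[x]word_ofK -[y]word_ofK -word_eval_inv -word_eval_cat.
move=> /lim_kernelP Fx /lim_kernelP Fy; apply/lim_kernelP.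
apply: filterS (filterI Fx Fy) => n /= [ex ey].
rewrite word_affine_cat (word_affine_inv _ (lim_ratio_neq0 n)).
by rewrite ex ey /= invr1 !mul1r oppr0 addr0.
Qed.

Lemma lim_kernel_conj g x : lim_kernel x -> lim_kernel (x ^ g)%g.
Proof.
rewrite -[x]word_ofK -[g]word_ofK conjgE -word_eval_inv -!word_eval_cat.
move=> /lim_kernelP Fx; apply/lim_kernelP; apply: filterS Fx => n /= ex.
have p0 := word_affine_neq0 (lim_ratio_neq0 n) (@word_of _ G g).
rewrite !word_affine_cat (word_affine_inv _ (lim_ratio_neq0 n)).
by rewrite ex /= !mul1r add0r mulVf// addNr.
Qed.

(** For most [n] the element is a power of [b] and acts as the translation by its exponent, which is
    therefore 0. *)
Lemma lim_E_kernel x : @lim_E m xi_ G U x -> lim_kernel x -> x = 1%g.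
Proof.
move=> Ex Fx; rewrite -[x]word_ofK -[1%g](word_eval_nil (@mg_gen _ G)).
apply/(lim_eq UU G_lim); apply: filterS (filterI Ex Fx) => n /= [[k [l e]] ax].
have bV (H : groupType) (b : H) j : ((b^-1) ^+ j = (b ^+ j)^-1)%g.
  by elim: j => [|j IHj]; rewrite ?expg0 ?invg1// expgS IHj expgSr invgM.
have := @BS_affine m (xi_ n) m_neq0 (xi_neq0 n) (@word_of _ G x)
  (nseq k (b_, false) ++ nseq l (b_, true)).
rewrite word_eval_cat !word_eval_nseq /letter_val/= bV => /(_ e).
rewrite ax word_affine_cat !word_affine_b /= !mul1r => -[/eqP].
rewrite eq_sym subr_eq0 eqr_nat => /eqP kl.
by rewrite e kl mulgV word_eval_nil.
Qed.

Definition lim_unimodular (x : G) : Prop := U [set n | (A n (word_of x)).1 = 1].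

Lemma lim_unimodularP w : lim_unimodular (evG w) <-> U [set n | (A n w).1 = 1].
Proof.
have e : evG (word_of (evG w)) = evG w by exact: word_ofK.
by split=> h; apply: filterS (filterI (lim_affine_eq e) h) => n [/= ->].
Qed.

Lemma derived1_unimodular : derived 1 `<=` lim_unimodular.
Proof.
apply: subgroup_gen_sub.
  split=> [|x y].
    rewrite -(word_eval_nil (@mg_gen _ G)); apply/lim_unimodularP.
    exact: filterS filterT.
  rewrite -[x]word_ofK -[y]word_ofK -word_eval_inv -word_eval_cat.
  move=> /lim_unimodularP Fx /lim_unimodularP Fy; apply/lim_unimodularP.
  apply: filterS (filterI Fx Fy) => n /= [ex ey].
  rewrite word_affine_cat (word_affine_inv _ (lim_ratio_neq0 n)).
  by rewrite /= ex ey invr1 mulr1.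
move=> _ [[x y] _ <-] /=; rewrite commgEl conjgE -[x]word_ofK -[y]word_ofK.
rewrite -!word_eval_inv -!word_eval_cat; apply/lim_unimodularP.
apply: filterS filterT => n _ /=; have y0 := lim_ratio_neq0 n.
have x1 := word_affine_neq0 y0 (@word_of _ G x).
have x2 := word_affine_neq0 y0 (@word_of _ G y).
rewrite !word_affine_cat !(word_affine_inv _ y0) /=.
by field; rewrite x1 x2.
Qed.

(** By [derived1_unimodular] the elements of the derived subgroup act as translations, and
    translations commute. *)
Lemma derived2_kernel : derived 2 `<=` lim_kernel.
Proof.
apply: subgroup_gen_sub; first exact: lim_kernel_subgroup.
move=> _ [[x y] /= [/derived1_unimodular + /derived1_unimodular +] <-].
rewrite commgEl conjgE -[x]word_ofK -[y]word_ofK.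
rewrite -!word_eval_inv -!word_eval_cat.
move=> /lim_unimodularP ux /lim_unimodularP uy; apply/lim_kernelP.
apply: filterS (filterI ux uy) => n /= [ex ey]; have y0 := lim_ratio_neq0 n.
rewrite !word_affine_cat !(word_affine_inv _ y0) /= ex ey.
by congr (_, _); rewrite ?invr1 ?mul1r//; lra.
Qed.

(** * Folner sets of lamp configurations *)

Section LampFolner.
Variable N : nat.

Let I : finType := ('I_N.+1 * {ffun 'I_N.+1 -> 'I_N.+1})%type.

Definition lamp_block (c : {ffun 'I_N.+1 -> 'I_N.+1}) (i : 'I_N.+1) : word 2 :=
  nseq i (a_, true) ++ nseq (c i) (b_, false) ++ nseq i (a_, false).

(* Modulo the kernel, the limit group is the wreath product of Z by Z: the word
   puts the lamps c i at the positions p.1 - i, so that multiplication by a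
   only moves p.1 and multiplication by b only changes the lamp c p.1. *)
Definition lamp_word (p : I) : word 2 :=
  nseq p.1 (a_, false) ++ flatten [seq lamp_block p.2 i | i <- enum 'I_N.+1].

Definition lamp_value (y : rat) (c : {ffun 'I_N.+1 -> 'I_N.+1}) : rat :=
  \sum_i (c i)%:R * y^-1 ^+ i.

Lemma word_affine_lamp (y : rat) (p : I) : y != 0 ->
  word_affine y (lamp_word p) = (y ^+ p.1, y ^+ p.1 * lamp_value y p.2).
Proof.
move=> y0; rewrite /lamp_word word_affine_cat word_affine_a /= add0r.
suff -> : word_affine y (flatten [seq lamp_block p.2 i | i <- enum 'I_N.+1]) =
    (1, \sum_(i <- enum 'I_N.+1) (p.2 i)%:R * y^-1 ^+ i).
  by rewrite mulr1 big_enum.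
elim: (enum 'I_N.+1) => [|i s IHs]; first by rewrite big_nil.
rewrite /= word_affine_cat IHs big_cons /lamp_block !word_affine_cat.
rewrite !word_affine_a word_affine_b /= !mul1r addr0 add0r -exprMn mulVf// expr1n.
by rewrite !mul1r mulrC.
Qed.

Local Notation lamp p := (evG (lamp_word p)).

(** For most [n] both words act by the same affine map. Equal translation parts make [xi_n / m] a
    root of the polynomial with coefficients [c k - d k], which vanishes because [|xi_n / m|] is
    arbitrarily large. Equal linear parts are powers of a number of absolute value above 1, so the
    positions agree. *)
Lemma lamp_inj (p q : I) : lim_kernel ((lamp p)^-1 * lamp q)%g -> p = q.
Proof.
move=> /lim_kernel_eqP pq; case: p q pq => [i c] [j d] pq.
pose P : {poly rat} := \sum_(k < N.+1) ((c k)%:R - (d k)%:R) *: 'X^(N - k).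
have PE y : y != 0 -> P.[y] = y ^+ N * (lamp_value y c - lamp_value y d).
  move=> y0; rewrite /P horner_sum /lamp_value -sumrB mulr_sumr.
  apply: eq_bigr => k _; rewrite hornerZ hornerXn -mulrBl mulrCA; congr (_ * _).
  have kN : (k <= N)%N by rewrite -ltnS.
  by rewrite -[X in _ = y ^+ X * _](subnK kN) exprD exprVn mulfK// expf_neq0.
have P0 : P = 0.
  apply/eqP/negPn/negP => /poly_bounded_below[C [e [e0 CP]]].
  have [n /= [En]] := filter_ex (filterI pq (lim_ratio_large (Num.max C 1))).
  rewrite gt_max => /andP[/CP Pn y1]; move: En.
  rewrite !word_affine_lamp ?lim_ratio_neq0//= => -[ij].
  rewrite ij => /(mulfI (expf_neq0 _ (lim_ratio_neq0 n))) cd.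
  by move: Pn; rewrite PE ?lim_ratio_neq0// cd subrr mulr0 normr0 leNgt e0.
have cd : c = d.
  apply/ffunP => k; apply: val_inj => /=; apply/eqP; rewrite -(eqr_nat rat).
  rewrite -subr_eq0; have /(congr1 (fun p : {poly rat} => p`_(N - k))) := P0.
  rewrite coef0 /P coef_sum (bigD1 k)//= coefZ coefXn eqxx mulr1 big1 ?addr0.
    by move=> ->.
  move=> l lk; rewrite coefZ coefXn; case: eqP => [kl|_]; last by rewrite mulr0.
  case/negP: lk; apply/eqP/val_inj; have := ltn_ord k; have := ltn_ord l.
  by move: kl => /=; lia.
have [n /= [En]] := filter_ex (filterI pq (lim_ratio_large 1)).
rewrite !word_affine_lamp ?lim_ratio_neq0//= in En * => y1.
move: En => [/(congr1 Num.norm)]; rewrite !normrX => ij _.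
congr (_, _) => //; apply: val_inj; apply: ieexprIn ij.
  by rewrite normr_gt0 lim_ratio_neq0.
by rewrite gt_eqF.
Qed.

Lemma lamp_value_update y (c d : {ffun 'I_N.+1 -> 'I_N.+1}) i e : y != 0 ->
  (forall k, k != i -> d k = c k) -> (d i)%:R = (c i)%:R + e :> rat ->
  y ^+ i * lamp_value y d = e + y ^+ i * lamp_value y c.
Proof.
move=> y0 dc de; rewrite /lamp_value (bigD1 i)//= [in RHS](bigD1 i)//= de.
rewrite (eq_bigr (fun k : 'I_N.+1 => (c k)%:R * y^-1 ^+ k)) => [|k ki].
  have ye : y ^+ i * (e * y^-1 ^+ i) = e.
    by rewrite mulrCA -exprMn mulfV// expr1n mulr1.
  by rewrite mulrDl !mulrDr ye; ring.
by rewrite dc.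
Qed.

Local Notation escapes := (escaping lim_kernel (fun p => lamp p)).

Lemma escaping_sub c (P : {pred I}) (f : I -> I) :
  (forall p n, p \notin P ->
    A n (lamp_word (f p)) = A n (c :: lamp_word p)) ->
  (#|escapes (letter_val (@mg_gen _ G) c)| <= #|P|)%N.
Proof.
move=> fP; apply/subset_leq_card/fintype.subsetP => p; rewrite inE.
apply: contraNT => pP; apply/existsP; exists (f p); apply/eqP.
apply/(coset_class_eq lim_kernel_subgroup).
have -> : (letter_val (@mg_gen _ G) c * lamp p)%g = evG (c :: lamp_word p).
  by rewrite word_eval_cons.
by apply/lim_kernel_eqP; apply: filterS filterT => n _; exact: fP.
Qed.

Lemma card_position (k : 'I_N.+1) :
  (N.+1 * #|[pred p : I | p.1 == k]| <= #|I|)%N.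
Proof.
apply: (@card_fibers _ _ _ (fun l p => (l, p.2))) => l l' [i c] [j d].
by rewrite !inE /= => /eqP-> /eqP-> [-> ->].
Qed.

Lemma card_lamp (k : 'I_N.+1) :
  (N.+1 * #|[pred p : I | p.2 p.1 == k]| <= #|I|)%N.
Proof.
pose f (l : 'I_N.+1) (p : I) : I :=
  (p.1, [ffun i => if i == p.1 then l else p.2 i]).
apply: (@card_fibers _ _ _ f) => l l' [i c] [j d].
rewrite !inE /= => /eqP ci /eqP dj [ij /ffunP e]; rewrite -ij in dj e *.
have := e i; rewrite !ffunE eqxx => -> ; split=> //; congr (_, _); apply/ffunP => x.
by have := e x; rewrite !ffunE; case: eqP => [->|//]; rewrite ci dj.
Qed.

(** A letter [a] or [a^-1] leaves the set only from an extreme position, and [b] or [b^-1] only when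
    the lamp at the current position is extreme. Either way this is at most one configuration in
    [N.+1]. *)
Lemma escaping_letter c :
  (N.+1 * #|escapes (letter_val (@mg_gen _ G) c)| <= #|I|)%N.
Proof.
have bound (P : {pred I}) f : (N.+1 * #|P| <= #|I|)%N ->
    (forall p n, p \notin P -> A n (lamp_word (f p)) = A n (c :: lamp_word p)) ->
    (N.+1 * #|escapes (letter_val (@mg_gen _ G) c)| <= #|I|)%N.
  by move=> PI /escaping_sub; rewrite -(leq_pmul2l (ltn0Sn N)) => /leq_trans; apply.
case: c bound => x e bound; have [xE|xE] := ord2_case x; rewrite {}xE in bound *;
  case: e bound => bound.
- apply: (bound [pred p : I | p.1 == ord0] (fun p : I => (inord p.1.-1, p.2) : I)).
    exact: card_position.
  move=> [i c] n; rewrite !inE /= => i0; have y0 := lim_ratio_neq0 n.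
  rewrite !word_affine_lamp//= inordK; last by have := ltn_ord i; lia.
  have ip : (0 < i)%N by rewrite lt0n.
  by rewrite -[in RHS](prednK ip) exprS -mulrA !(mulKf y0).
- apply: (bound [pred p : I | p.1 == ord_max] (fun p : I => (inord p.1.+1, p.2) : I)).
    exact: card_position.
  move=> [i c] n; rewrite !inE -val_eqE /= => iN; have y0 := lim_ratio_neq0 n.
  rewrite !word_affine_lamp//= inordK; last by have := ltn_ord i; lia.
  by rewrite exprS mulrA.
- apply: (bound [pred p : I | p.2 p.1 == ord0] (fun p : I =>
    (p.1, [ffun k => if k == p.1 then inord (p.2 k).-1 else p.2 k]) : I)).
    exact: card_lamp.
  move=> [i c] n; rewrite !inE -val_eqE /= => ci; have y0 := lim_ratio_neq0 n.
  rewrite !word_affine_lamp//=; congr (_, _); apply: lamp_value_update => //.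
    by move=> k ki; rewrite ffunE (negbTE ki).
  rewrite ffunE eqxx inordK; last exact: leq_ltn_trans (leq_pred _) (ltn_ord _).
  by rewrite -[in RHS](@prednK (c i)) ?lt0n// -natr1 addrK.
- apply: (bound [pred p : I | p.2 p.1 == ord_max] (fun p : I =>
    (p.1, [ffun k => if k == p.1 then inord (p.2 k).+1 else p.2 k]) : I)).
    exact: card_lamp.
  move=> [i c] n; rewrite !inE -val_eqE /= => ci; have y0 := lim_ratio_neq0 n.
  rewrite !word_affine_lamp//=; congr (_, _); apply: lamp_value_update => //.
    by move=> k ki; rewrite ffunE (negbTE ki).
  rewrite ffunE eqxx inordK; last by rewrite ltnS ltn_neqAle ci -ltnS ltn_ord.
  by rewrite natr1.
Qed.

Lemma escaping_word w : (N.+1 * #|escapes (evG w)| <= size w * #|I|)%N.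
Proof.
elim: w => [|c w IHw]; first by rewrite word_eval_nil escaping1 muln0.
rewrite word_eval_cons -/(letter_val (@mg_gen _ G) c) /= [leqRHS]mulSn.
apply: (@leq_trans (N.+1 * (#|escapes (evG w)| +
    #|escapes (letter_val (@mg_gen _ G) c)|))%N).
  rewrite leq_mul2l /=.
  exact: (escapingM lim_kernel_subgroup lamp_inj).
by rewrite mulnDr addnC leq_add// escaping_letter.
Qed.

End LampFolner.

Lemma lim_folner (R : realType) (k : seq G) (e : R) : 0 < e ->
  exists (I : finType) (h : I -> G),
    [/\ (0 < #|I|)%N, (forall i j, lim_kernel ((h i)^-1 * h j)%g -> i = j) &
      forall g, g \in k -> (1 - e) * #|I|%:R <=
        #|[pred i | [exists j, coset_class lim_kernel (h i) ==
                               coset_class lim_kernel (g * h j)%g]]|%:R].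
Proof.
(* [M] bounds words for inverses because [good_card] counts what escapes under [g^-1]. As
   [N.+1 > M / e], the escaping proportion is at most [M / N.+1 <= e]. *)
move=> e0; pose M := (\max_(g <- k) size (@word_of _ G g^-1%g))%N.
pose N := Num.truncn (M%:R / e).
exists ('I_N.+1 * {ffun 'I_N.+1 -> 'I_N.+1})%type, (fun p => evG (lamp_word p)).
split; [|exact: lamp_inj|].
  by apply/card_gt0P; exists (ord0, [ffun=> ord0]).
move=> g gk; rewrite (good_card _ lim_kernel_subgroup).
have := @escaping_word N (word_of g^-1%g); rewrite word_ofK.
set x := #|escaping _ _ _|; set n := #|_|.
move=> xn; have xle : (x <= n)%N by exact: max_card.
rewrite natrB// mulrBl mul1r lerD2l lerN2.
have N0 : 0 < N.+1%:R :> R by rewrite ltr0n.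
rewrite -(ler_pM2l N0); apply: (@le_trans _ _ (M%:R * n%:R)).
  rewrite -!natrM ler_nat (leq_trans xn)// leq_mul2r; apply/orP; right.
  by apply: (@leq_bigmax_seq _ _ _ (fun g => size (@word_of _ G g^-1%g))).
rewrite mulrA ler_wpM2r// -ler_pdivrMr//.
have Me0 : 0 <= M%:R / e by rewrite divr_ge0// ltW.
by have /andP[_ /ltW] := truncn_itv Me0.
Qed.

End UltralimitAffine.

(** * From the metric on marked groups to the ultrafilter *)

Lemma marked_dist_lt (R : realType) k (G1 G2 : marked_group k) (w : word k) :
  marked_dist R G1 G2 < expR (- (size w)%:R) ->
  word_eval (@mg_gen _ G1) w = 1%g <-> word_eval (@mg_gen _ G2) w = 1%g.
Proof.
rewrite /marked_dist; case: pselect => [ex|nex _]; last first.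
  by apply: contrapT => h; apply: nex; exists (size w); apply/asboolP; exists w.
case: ex_minnP => n _ n_min; rewrite ltr_expR ltrN2 ltr_nat => wn.
apply: contrapT => h; move: wn; apply/negP; rewrite -leqNgt.
by apply: n_min; apply/asboolP; exists w.
Qed.

Theorem corollary4 (R : realType) (m : int) (m_neq0 : m != 0) (xi : madic m)
    (G : marked_group 2) (HG : is_BSbar R xi G) :
  haagerup R G /\ residually_solvable G.
Proof.
case: HG => xi_ [xi_neq0 xi_oo _ xi_G].
(* [U] refines the filter of cofinite sets, so whatever holds eventually along the sequence holds
   for most [n]. *)
have [U [UU oU]] := ultraFilterLemma eventually_filter.
have UF := @ultra_proper _ _ UU.
have G_lim (w : word 2) :
    U [set n | word_eval (@mg_gen _ (BS m (xi_ n))) w = 1%g <->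
               word_eval (@mg_gen _ G) w = 1%g].
  apply: oU; have := expR_gt0 (- (size w)%:R : R).
  move/cvgrPdist_lt : xi_G => /[apply]; apply: filterS => n /=.
  rewrite sub0r normrN => /(le_lt_trans (ler_norm _)).
  exact: marked_dist_lt.
have xi_large k : U [set n | (k < `|xi_ n|)%N].
  by apply: oU; exact: (xi_oo _ (nbhs_infty_gt k)).
pose T := lim_splitting UU G_lim.
have F_E x : hnn_E T x -> lim_kernel m xi_ U x -> x = 1%g.
  exact: lim_E_kernel m_neq0 xi_neq0 UU G_lim x.
split.
  (* Words in the two generators are countable; a number that codes no word is sent to the empty
     word, hence to 1. *)
  apply: (@hnn_haagerup R G T (lim_kernel m xi_ U)
    (fun n => word_eval (@mg_gen _ G) (odflt [::] (unpickle n)))) => //.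
  - exact: lim_kernel_subgroup.
  - exact: lim_kernel_conj.
  - by move=> g; exists (pickle (word_of g)); rewrite pickleK /= word_ofK.
  - by move=> k e; exact: lim_folner.
apply: residually_solvable_derived; apply: (@hnn_derived_trivial _ T) => x Ex dx.
by apply: F_E => //; exact: derived2_kernel.
Qed.
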